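(* Let $(\Sigma_2,\sigma)$ be the full shift on two symbols. (a) The set of points that are members of Denjoy minimal sets in $(\Sigma_2,\sigma)$ is dense in $\Sigma_2$. (b) The set of invariant measures supported on Denjoy minimal sets is weakly dense in the set of invariant measures; i.e. $\mathcal{D}(\Sigma_2,\sigma)$ (viewed as a subset of $\mathcal{M}(\Sigma_2,\sigma)$) is dense in $\mathcal{M}(\Sigma_2,\sigma)$.
   Context: $\Sigma_2=\{0,1\}^{\mathbb{Z}}$ with the product topology and $\sigma$ is the shift homeomorphism, $(\sigma(s))_i=s_{i+1}$. A Denjoy example is an (orientation-preserving) circle homeomorphism $g:S^1\to S^1$ with irrational rotation number such that $(S^1,g)$ is not minimal (not every orbit is dense); it has a unique minimal set. A dynamical system (a homeomorphism of a compact metric space) is called a Denjoy minimal set if it is topologically conjugate to the restriction of some Denjoy example to its unique minimal set. Every Denjoy minimal set has exactly one invariant Borel probability measure. $\mathcal{D}(\Sigma_2,\sigma)$ is the set of compact $\sigma$-invariant $Y\subset\Sigma_2$ such that $(Y,\sigma|_Y)$ is a Denjoy minimal set. $\mathcal{M}(\Sigma_2,\sigma)$ is the set of $\sigma$-invariant Borel probability measures on $\Sigma_2$ with the weak topology: $\mu_n\to\mu_0$ iff $\int f\,d\mu_n\to\int f\,d\mu_0$ for all continuous $f:\Sigma_2\to\mathbb{R}$. $\mathcal{D}(\Sigma_2,\sigma)$ is regarded as a subset of $\mathcal{M}(\Sigma_2,\sigma)$ by identifying each Denjoy minimal set with its unique invariant probability measure. *)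

(* Defs.v *)
From HB Require Import structures.
From mathcomp Require Import all_boot all_order all_algebra.
From mathcomp Require Import all_classical all_reals all_analysis.

Set Implicit Arguments.
Unset Strict Implicit.
Unset Printing Implicit Defensive.

Import Order.TTheory GRing.Theory Num.Theory.
Import numFieldNormedType.Exports.

Local Open Scope classical_set_scope.
Local Open Scope ring_scope.

(* A dynamical system is given by a subset X of a topological space T and a
   map f : T -> T of which only the values on X matter.  *)
Section systems.
Context {T U : topologicalType}.

Definition homeo_between (X : set T) (Y : set U) (h : T -> U) : Prop :=
  exists k : U -> T,
    [/\ set_fun X Y h /\ set_fun Y X k,
        {within X, continuous h}, {within Y, continuous k},
        {in X, cancel h k} & {in Y, cancel k h}].

Definition conjugate_systems (X : set T) (f : T -> T) (Y : set U) (g : U -> U) :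
    Prop :=
  exists2 h : T -> U, homeo_between X Y h & forall x, X x -> h (f x) = g (h x).

Definition invariant_set (f : T -> T) (K : set T) : Prop := f @` K = K.

Definition minimal_set (X : set T) (f : T -> T) (K : set T) : Prop :=
  [/\ K `<=` X, K !=set0, compact K, invariant_set f K &
      forall L : set T, L `<=` K -> L !=set0 -> compact L ->
        invariant_set f L -> L = K].

(* The full (two-sided) orbit, for f restricting to a bijection of X.  *)
Definition orbit_in (X : set T) (f : T -> T) (x : T) : set T :=
  [set y | X y /\ exists n, iter n f x = y \/ iter n f y = x].

Definition minimal_system (X : set T) (f : T -> T) : Prop :=
  forall x, X x -> X `<=` closure (orbit_in X f x).

End systems.

Section circle.
Context {R : realType}.

Definition circle : set (R * R) := [set z | z.1 ^+ 2 + z.2 ^+ 2 = 1].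

Definition circle_cover (t : R) : R * R :=
  (cos (2 * pi * t), sin (2 * pi * t)).

Definition is_lift (F : R -> R) (g : R * R -> R * R) : Prop :=
  continuous F /\ forall t, circle_cover (F t) = g (circle_cover t).

Definition orientation_preserving (g : R * R -> R * R) : Prop :=
  exists2 F : R -> R, is_lift F g & {homo F : s t / s < t}.

(* The rotation number is an element of R / Z; its representatives are the
   translation numbers of the lifts of g.  *)
Definition is_rotation_number (g : R * R -> R * R) (rho : R) : Prop :=
  exists2 F : R -> R, is_lift F g &
    forall t, (iter n F t - t) / n%:R @[n --> \oo] --> rho.

Definition denjoy_example (g : R * R -> R * R) : Prop :=
  [/\ homeo_between circle circle g,
      orientation_preserving g,
      exists2 rho, is_rotation_number g rho & irrational rho &
      ~ minimal_system circle g].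

End circle.

Definition denjoy_minimal (R : realType) (T : topologicalType)
    (Y : set T) (f : T -> T) : Prop :=
  exists (g : R * R -> R * R) (K : set (R * R)),
    [/\ denjoy_example g, minimal_set circle g K & conjugate_systems Y f K g].

Definition Sigma2 : Type := prod_topology (fun _ : int => bool).

HB.instance Definition _ := Pointed.on Sigma2.
HB.instance Definition _ := Nbhs.on Sigma2.
HB.instance Definition _ := Topological.on Sigma2.
HB.instance Definition _ := Uniform.on Sigma2.

Definition full_shift (s : Sigma2) : Sigma2 := fun i => s (i + 1).

Definition denjoy_sets (R : realType) : set (set Sigma2) :=
  [set Y | [/\ compact Y, invariant_set full_shift Y & denjoy_minimal R Y full_shift]].

Definition borel_Sigma2 := g_sigma_algebraType (@open Sigma2).

Definition invariant_measure (R : realType) : Type :=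
  {mu : probability borel_Sigma2 R |
    forall A : set borel_Sigma2, measurable A -> mu (full_shift @^-1` A) = mu A}.

HB.instance Definition _ (R : realType) := gen_eqMixin (invariant_measure R).
HB.instance Definition _ (R : realType) := gen_choiceMixin (invariant_measure R).

Definition integrals (R : realType) (mu : invariant_measure R) :
    prod_topology (fun _ : continuousType Sigma2 R => R) :=
  fun f => Rintegral (sval mu : set borel_Sigma2 -> \bar R) setT f.

(* The coarsest topology making mu |-> \int f dmu continuous for every
   continuous f : Sigma2 -> R.  *)
Definition invariant_measures (R : realType) : Type :=
  initial_topology (@integrals R).

HB.instance Definition _ (R : realType) := Topological.on (invariant_measures R).

Lemma cvg_invariant_measuresP (R : realType) (mu_ : nat -> invariant_measures R)
    (mu : invariant_measures R) :
  mu_ @ \oo --> mu <->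
  forall f : continuousType Sigma2 R,
    integrals (mu_ n) f @[n --> \oo] --> integrals mu f.
Proof.
split=> [cmu f|cmu].
  apply: (@cvg_comp _ _ _ mu_ (fun nu => integrals nu f) _ _ _ cmu).
  have ci : {for mu, continuous (@integrals R : invariant_measures R -> _)}.
    exact: initial_continuous.
  apply: (@continuous_comp _ _ _ (@integrals R : invariant_measures R -> _)
    (fun u : prod_topology (fun _ : continuousType Sigma2 R => R) => u f)) => //.
  exact: proj_continuous.
have cp : @integrals R (mu_ n) @[n --> \oo] --> @integrals R mu.
  apply/cvg_sup => f U [_ [[B Bop <-] Bf] BU].
  apply: (filterS BU); apply: (cmu f).
  exact: open_nbhs_nbhs.
move=> U [_ [[B Bop <-] Bmu] BU].
apply: (filterS BU); apply: cp; exact: open_nbhs_nbhs.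
Qed.

(* The invariant measures carried by a Denjoy minimal set Y; as (Y, full_shift) is
   uniquely ergodic, each Y contributes exactly one such measure.  *)
Definition denjoy_measures (R : realType) : set (invariant_measures R) :=
  [set mu | exists2 Y : set Sigma2, denjoy_sets R Y &
     sval (mu : invariant_measure R) (Y : set borel_Sigma2) = 1%E].

(* Main.v *)
(* Blowing up the orbit [Z a + Z] of an irrational rotation by [a] turns each of
   its points into an interval, and moving these intervals affinely gives a
   Denjoy homeomorphism whose minimal set is what remains outside their
   interiors.  Choose cut points in the intervals over [0, a, ..., N a], where
   [N a < 1], and label the [N + 1] arcs between them by letters
   [W 0, ..., W N] with [W N <> W 0].  Every jump of the label then lies in the
   single blown up orbit and there is one over [0], so the itinerary map is
   injective on the minimal set and its image [Y] is a Denjoy minimal set in the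
   shift.  A point over [[i a, (i + 1) a)] reads [W (i + k)] at place [k], so
   taking for [W] a window of a given sequence proves (a).

   For (b), Lebesgue measure on [[0, 1)] is carried to an invariant measure
   on [Y] which, for [a] close to [1 / N], is close to the empirical measure of
   the word [W].  The invariance of [mu] allows one to take for [W] the
   concatenation of the initial blocks of finitely many points at which the
   Birkhoff averages of the given functions have nearly the right mean. *)
From HB Require Import structures.
Require Import Defs.
From mathcomp Require Import all_boot all_order all_algebra.
From mathcomp Require Import all_classical all_reals all_analysis.
From mathcomp Require Import measurable_realfun.
From mathcomp Require Import ring lra zify.

Set Implicit Arguments.
Unset Strict Implicit.
Unset Printing Implicit Defensive.

Import Order.TTheory GRing.Theory Num.Theory.
Import numFieldNormedType.Exports.

Local Open Scope classical_set_scope.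
Local Open Scope ring_scope.

(** * Irrational rotations *)

Section irrational_rotation.
Context {R : realType}.
Implicit Types (a b t s x : R) (k m : int).

Lemma expr2V_lt x : 0 < x -> exists n, 2 ^- n < x.
Proof.
move=> x0; have /upper_nthrootP := leqnn (Num.bound x^-1).
set n := Num.bound _ => xn; exists n.
by rewrite -(invrK x) ltf_pV2 // ?posrE ?invr_gt0 // exprn_gt0.
Qed.

(** Rational translates of [pi] are irrational and dense. *)
Lemma irrational_between a b : a < b -> exists2 x, irrational x & a < x < b.
Proof.
move=> ab; have /rat_in_itvoo[q] : a - pi < b - pi by lra.
rewrite in_itv /= => /andP[aq qb]; exists (ratr q + pi); last by lra.
move=> [r _ qr]; apply: (@pi_irrationnal R); exists (r - q) => //.
by rewrite rmorphB /= qr; ring.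
Qed.

Variable a : R.
Hypothesis a_irr : irrational a.

Lemma irrational_intM k m : k%:~R * a = m%:~R -> k = 0.
Proof.
move=> kam; apply/eqP; apply/negPn/negP => k0; apply: a_irr.
exists (m%:~R / k%:~R) => //.
rewrite fmorph_div /= !ratr_int -kam mulrAC mulfV ?mul1r//.
by rewrite intr_eq0.
Qed.

(* Euclid's algorithm on [1] and [x] at least halves the positive element [x]
   of the group [Z a + Z]. *)
Lemma rotation_orbit_halving n :
  exists k m, let x := k%:~R * a + m%:~R in
    [/\ k != 0, 0 < x <= 1 & x <= 2 ^- n].
Proof.
elim: n => [|n [k [m [k0 /andP[x0 x1] xn]]]].
  exists 1, (- Num.floor a) => /=.
  have /andP[] := floor_itv a; rewrite intrD rmorphN /= !mul1r => h1 h2.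
  have a0 : (Num.floor a)%:~R != a.
    apply/eqP => h; have := @irrational_intM 1 (Num.floor a).
    by rewrite mul1r => /(_ (esym h)).
  have {}a0 : (Num.floor a)%:~R < a by rewrite lt_neqAle a0.
  by rewrite expr0 invr1; split=> //; lra.
set x := k%:~R * a + m%:~R in x0 x1 xn *.
pose q := Num.floor x^-1.
have /andP[q1 q2] := floor_itv x^-1; rewrite -/q intrD in q1 q2.
have qx : q%:~R * x <= 1 by rewrite -ler_pdivlMr // div1r.
have qx1 : 1 < (q%:~R + 1) * x by rewrite -ltr_pdivrMr // div1r.
have q0 : 1 <= q by rewrite /q floor_ge_int invf_ge1.
(* [r] is the remainder of 1 modulo [x]. It cannot vanish, since that would make a nonzero integer
   multiple of [a] an integer. *)
pose r := 1 - q%:~R * x.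
have rE : r = (- q * k)%:~R * a + (1 - q * m)%:~R.
  by rewrite /r /x !(intrD, intrM, rmorphN) /=; ring.
have r0 : 0 < r.
  rewrite lt_neqAle; apply/andP; split; last by rewrite /r; lra.
  apply/eqP; rewrite rE => h.
  have /eqP : - q * k = 0.
    by apply: (@irrational_intM _ (- (1 - q * m))); rewrite rmorphN /=; lra.
  by rewrite mulf_eq0 (negbTE k0) orbF oppr_eq0; lia.
have exS : 2 ^- n.+1 = 2 ^- n / 2 :> R by rewrite exprS invfM mulrC.
have rx : r < x by rewrite /r; lra.
(* Both [r] and [x - r] are positive elements of the group and they add up to [x], so the smaller
   one is at most [x / 2]. *)
have [rh|rh] := lerP r (x / 2).
  exists (- q * k), (1 - q * m) => /=; rewrite -rE; split => //.
  - by rewrite mulf_neq0 // oppr_eq0 gt_eqF // (lt_le_trans ltr01 q0).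
  - lra.
  - by rewrite exS; lra.
exists ((1 + q) * k), (m - (1 - q * m)) => /=.
have -> : ((1 + q) * k)%:~R * a + (m - (1 - q * m))%:~R = x - r.
  by rewrite rE /x !(intrD, intrM, rmorphN) /=; ring.
split => //.
- by rewrite mulf_neq0 // gt_eqF // addr_gt0 // (lt_le_trans ltr01 q0).
- lra.
- by rewrite exS; lra.
Qed.

(** With a group element [x] shorter than the interval, the first multiple of [x] beyond [s] still
    lies before [t]. *)
Lemma rotation_orbit_dense s t : s < t ->
  exists k m, s < k%:~R * a + m%:~R < t.
Proof.
move=> st.
have [n nst] : exists n, 2 ^- n < t - s by apply: expr2V_lt; rewrite subr_gt0.
have [k [m [_ ]]] := rotation_orbit_halving n.
set x := k%:~R * a + m%:~R => /andP[x0 _] xn.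
pose q := Num.floor (s / x).
have /andP[q1 q2] := floor_itv (s / x); rewrite -/q intrD in q1 q2.
exists ((q + 1) * k), ((q + 1) * m).
have -> : ((q + 1) * k)%:~R * a + ((q + 1) * m)%:~R = (q%:~R + 1) * x.
  by rewrite /x !(intrD, intrM) /=; ring.
move: q1 q2; rewrite ler_pdivlMr // ltr_pdivrMr // => q1 q2.
by rewrite q2 /=; lra.
Qed.

End irrational_rotation.

(** * A strictly increasing function of degree one that jumps exactly on [Z a + Z] *)

Section jump_function.
Context {R : realType}.
Variable a : R.
Implicit Types (s t : R) (n N : nat) (k m : int).

(* Enumerates the integers with repetitions, which only lets some of the jumps
   of [jump_fun] add up. *)
Definition enum_int n : int := odflt 0 (unpickle n).

Lemma enum_int_surj k : exists n, enum_int n = k.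
Proof. by exists (pickle k); rewrite /enum_int pickleK. Qed.

(** For [t >= 0] and [k = enum_int n], this is the number of points of [k a + Z] in []0, t]]. The
    second floor makes it vanish at 0, which keeps the counts bounded in [n]. *)
Definition jump_count n t : int :=
  Num.floor (t - (enum_int n)%:~R * a) - Num.floor (- ((enum_int n)%:~R * a)).

Definition jump_term t : R ^nat := fun n => 2 ^- n.+2 * (jump_count n t)%:~R.

(** The weights [2 ^- n.+2] add up to 1/2. Together with the slope 1/2 they give degree one, and the
    linear part makes the function strictly increasing. *)
Definition jump_fun t : R := t / 2 + limn (series (jump_term t)).

Lemma jump_count_diff n s t : s <= t ->
  (0 : R) <= (jump_count n t)%:~R - (jump_count n s)%:~R <= t - s + 1.
Proof.
move=> st; rewrite -intrB /jump_count.
set x := _%:~R * a.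
have /andP[h1 h2] := floor_itv (t - x); have /andP[h3 h4] := floor_itv (s - x).
have h : Num.floor (s - x) <= Num.floor (t - x) by apply: le_floor; lra.
move: h; rewrite -(ler_int R) => h.
by rewrite !(intrD, rmorphN) /= in h1 h2 h3 h4 *; lra.
Qed.

Lemma jump_count0 n : jump_count n 0 = 0.
Proof. by rewrite /jump_count add0r subrr. Qed.

Lemma jump_count_abs n t : `|(jump_count n t)%:~R| <= `|t| + 1 :> R.
Proof.
have [t0|/ltW t0] := lerP 0 t.
  have := jump_count_diff n t0; rewrite jump_count0 !subr0 => /andP[h1 h2].
  by rewrite ger0_norm // ger0_norm.
have := jump_count_diff n t0; rewrite jump_count0 !sub0r => /andP[h1 h2].
by rewrite ler0_norm ?(ler0_norm t0) // -oppr_ge0.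
Qed.

Lemma is_cvg_half_series (c : R) : cvgn (series (fun n => c * 2 ^- n.+2)).
Proof.
rewrite (_ : (fun n => _) = geometric (c / 4) 2^-1); last first.
  apply/funext => n; rewrite /geometric /= -mulrA; congr (_ * _).
  by rewrite -exprVn !exprS; field.
by apply: is_cvg_geometric_series; rewrite ger0_norm; lra.
Qed.

Lemma lim_half_series : limn (series (fun n => 2 ^- n.+2 : R)) = 2^-1.
Proof.
rewrite (_ : (fun n => _) = geometric (4^-1) 2^-1); last first.
  apply/funext => n; rewrite /geometric /=.
  by rewrite -exprVn !exprS; field.
rewrite (cvg_lim _ (cvg_geometric_series _)) //; first by field.
by rewrite ger0_norm; lra.
Qed.

Lemma is_cvg_jump t : cvgn (series (jump_term t)).
Proof.
apply: normed_cvg; apply: (@series_le_cvg _ _ (fun n => (`|t| + 1) * 2 ^- n.+2)).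
- by move=> n; rewrite /=.
- by move=> n; rewrite mulr_ge0 ?invr_ge0 ?exprn_ge0 // addr_ge0.
- move=> n; rewrite /= /jump_term normrM ger0_norm ?invr_ge0 ?exprn_ge0 // mulrC.
  by rewrite ler_wpM2r ?invr_ge0 ?exprn_ge0 // jump_count_abs.
- exact: is_cvg_half_series.
Qed.

Definition jump_diff s t : R ^nat := jump_term t - jump_term s.

Lemma jump_funB s t :
  jump_fun t - jump_fun s = (t - s) / 2 + limn (series (jump_diff s t)).
Proof.
rewrite /jump_fun /jump_diff lim_seriesB; [ring|exact: is_cvg_jump..].
Qed.

Lemma is_cvg_jump_diff s t : cvgn (series (jump_diff s t)).
Proof. by apply: is_cvg_seriesB; exact: is_cvg_jump. Qed.

Lemma jump_diffE s t n : jump_diff s t n =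
  2 ^- n.+2 * ((jump_count n t)%:~R - (jump_count n s)%:~R).
Proof. by rewrite mulrBr. Qed.

Lemma jump_diff_ge0 s t n : s <= t -> 0 <= jump_diff s t n.
Proof.
move=> /(jump_count_diff n)/andP[h _]; rewrite jump_diffE.
by rewrite mulr_ge0 // invr_ge0 exprn_ge0.
Qed.

(** The terms of the series of differences are nonnegative, so all but one may be dropped. *)
Lemma jump_fun_ge s t n : s <= t ->
  (t - s) / 2 + jump_diff s t n <= jump_fun t - jump_fun s.
Proof.
move=> st; rewrite jump_funB lerD2l.
apply: (@le_trans _ _ (series (jump_diff s t) n.+1)); last first.
  apply: nondecreasing_cvgn_le; last exact: is_cvg_jump_diff.
  by apply: nondecreasing_series => i _ _; exact: jump_diff_ge0.
rewrite seriesEnat /= big_nat_recr //= lerDr sumr_ge0 // => i _.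
exact: jump_diff_ge0.
Qed.

Lemma jump_fun_mono s t : s < t -> jump_fun s < jump_fun t.
Proof.
move=> st; have := jump_fun_ge 0 (ltW st).
by have := jump_diff_ge0 0 (ltW st); lra.
Qed.

Lemma sum_half_tail N n : \sum_(N <= i < n) 2 ^- i.+2 <= 2 ^- N.+1 :> R.
Proof.
have [nN|/ltnW] := leqP n N; first by rewrite big_geq // invr_ge0 exprn_ge0.
move=> /subnK <-; rewrite addnC; move: (n - N)%N => {}n.
suff -> : \sum_(N <= i < N + n) 2 ^- i.+2 = 2 ^- N.+1 - 2 ^- (N + n).+1 :> R.
  by rewrite gerBl invr_ge0 exprn_ge0.
elim: n => [|n IH]; first by rewrite addn0 big_geq // subrr.
rewrite addnS big_nat_recr ?leq_addr //= IH.
have e (i : nat) : 2 ^- i.+1 = 2 ^- i / 2 :> R by rewrite exprS invfM mulrC.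
by rewrite (e (N + n).+1); lra.
Qed.

(** The first [N] terms cancel. On an interval of length at most 1 every other count grows by at
    most 2, so the tail is at most twice [2 ^- N.+1]. *)
Lemma jump_fun_le s t N : s <= t -> t <= s + 1 ->
  (forall n, (n < N)%N -> jump_count n s = jump_count n t) ->
  jump_fun t - jump_fun s <= (t - s) / 2 + 2 ^- N.
Proof.
move=> st ts hN; rewrite jump_funB lerD2l.
apply: limr_le; first exact: is_cvg_jump_diff.
apply: nearW => n; rewrite seriesEnat /=.
have le1 i : jump_diff s t i <= 2 ^- i.+2 * 2.
  rewrite jump_diffE ler_wpM2l ?invr_ge0 ?exprn_ge0 //.
  by have /andP[_] := jump_count_diff i st; lra.
have zero i : (i < N)%N -> jump_diff s t i = 0.
  by move=> iN; rewrite jump_diffE hN // subrr mulr0.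
have [nN|/ltnW Nn] := leqP n N.
  rewrite big_nat big1 ?invr_ge0 ?exprn_ge0 // => i /andP[_ in_].
  by rewrite zero // (leq_trans in_).
rewrite (big_cat_nat (leq0n _) Nn) /= big_nat big1 ?add0r; last first.
  by move=> i /andP[_ ?]; rewrite zero.
apply: (@le_trans _ _ (\sum_(N <= i < n) 2 ^- i.+2 * 2)).
  by apply: ler_sum => i _.
rewrite -mulr_suml.
have e (i : nat) : 2 ^- i.+1 = 2 ^- i / 2 :> R by rewrite exprS invfM mulrC.
by have := sum_half_tail N n; rewrite e; lra.
Qed.

Lemma jump_count1 n t : jump_count n (t + 1) = jump_count n t + 1.
Proof.
rewrite /jump_count addrAC floorDrz // floor1.
by rewrite addrAC.
Qed.

Lemma jump_fun1 t : jump_fun (t + 1) = jump_fun t + 1.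
Proof.
have := jump_funB t (t + 1).
have -> : jump_diff t (t + 1) = fun n => 2 ^- n.+2.
  by apply/funext => n; rewrite jump_diffE jump_count1 intrD /=; ring.
by rewrite lim_half_series; lra.
Qed.

(** The count indexed by an [n] with [enum_int n = k] grows by at least one across the point. The
    bound does not depend on [s] and [t], so it survives in the one-sided limits. *)
Lemma jump_fun_jump k m : exists n, forall s t,
  s < k%:~R * a + m%:~R < t -> 2 ^- n.+2 <= jump_fun t - jump_fun s.
Proof.
have [n nk] := enum_int_surj k; exists n => s t /andP[sk kt].
have st : s <= t by lra.
apply: le_trans (jump_fun_ge n st).
apply: (@le_trans _ _ (jump_diff s t n)); last by lra.
rewrite jump_diffE ler_peMr ?invr_ge0 ?exprn_ge0 // -intrB /jump_count nk.
have h1 : m <= Num.floor (t - k%:~R * a) by rewrite floor_ge_int; lra.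
have h2 : Num.floor (s - k%:~R * a) < m by rewrite floor_lt_int; lra.
have : (1 <= Num.floor (t - k%:~R * a) - Num.floor (- (k%:~R * a)) -
  (Num.floor (s - k%:~R * a) - Num.floor (- (k%:~R * a)))) by lia.
by rewrite -(ler_int R).
Qed.

(** Off the orbit none of the finitely many floors involved is taken at an integer. *)
Lemma jump_count_locally_constant t N :
  (forall k m, t != k%:~R * a + m%:~R) ->
  exists2 d, 0 < d & forall s, `|s - t| < d -> forall n, (n < N)%N ->
    jump_count n s = jump_count n t.
Proof.
move=> tka; elim: N => [|N [d d0 hd]]; first by exists 1.
set x := (enum_int N)%:~R * a; set f := Num.floor (t - x).
have /andP[h1 h2] := floor_itv (t - x); rewrite -/f intrD in h1 h2.
have {}h1 : f%:~R < t - x.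
  rewrite lt_neqAle h1 andbT; apply/eqP => h.
  by have /eqP := tka (enum_int N) f; apply; rewrite -/x h; ring.
exists (Num.min d (Num.min (t - x - f%:~R) (f%:~R + 1 - (t - x)))).
  by rewrite !lt_min d0 /=; lra.
move=> s; rewrite !lt_min => /and3P[sd s1 s2] n; rewrite ltnS leq_eqVlt.
move=> /predU1P[->|nN]; last exact: hd.
rewrite /jump_count -/x; congr (_ - _); apply: floor_def; rewrite intrD -/f.
by move: s1 s2; rewrite !ltr_norml; lra.
Qed.

Lemma jump_fun_cont t (e : R) : (forall k m, t != k%:~R * a + m%:~R) -> 0 < e ->
  exists s s', [/\ s < t, t < s' & jump_fun s' - jump_fun s < e].
Proof.
move=> tka e0; have [N Ne] : exists N, 2 ^- N < e / 2 by apply: expr2V_lt; lra.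
have [d d0 hd] := jump_count_locally_constant N tka.
(* The three bounds keep both ends where the first [N] counts are constant, bound the linear part by
   [e / 4], and make the interval no longer than 1, as [jump_fun_le] demands. *)
pose r := Num.min (d / 2) (Num.min (e / 4) (1 / 2)).
have rd : r <= d / 2 by rewrite /r ge_min lexx.
have re : r <= e / 4 by rewrite /r !ge_min lexx orbT.
have r1 : r <= 1 / 2 by rewrite /r !ge_min lexx !orbT.
have r0 : 0 < r by rewrite /r !lt_min; lra.
exists (t - r), (t + r); split; [lra|lra|].
apply: (@le_lt_trans _ _ ((t + r - (t - r)) / 2 + 2 ^- N)); last by lra.
apply: jump_fun_le; [lra|lra|] => n nN.
by rewrite !hd // ltr_norml; lra.
Qed.

End jump_function.

(* [lo t] and [hi t] are the ends of the fibre over [t] of a monotone degree one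
   map of the line whose nondegenerate fibres are those over [Z a + Z]. *)
Definition denjoy_fibres {R : realType} (a : R) (lo hi : R -> R) : Prop :=
  [/\ forall t, lo t <= hi t,
      forall s t, s < t -> hi s < lo t,
      forall u, exists t, lo t <= u <= hi t,
      forall t, lo (t + 1) = lo t + 1 /\ hi (t + 1) = hi t + 1 &
      forall t, lo t < hi t <-> exists k m : int, t = k%:~R * a + m%:~R].

(** * Fibres as the gaps between one-sided limits of the jump function *)

Section denjoy_fibres_exist.
Context {R : realType}.
Variables (a : R).
Local Notation H := (jump_fun a).
(** [lo] and [hi] are the left and right limits of [H]; the map with these fibres is the generalized
    inverse of [H]. *)
Let lo t := sup [set H s | s in [set s | s < t]].
Let hi t := inf [set H s | s in [set s | t < s]].

Let lo_le c t : (forall s, s < t -> H s <= c) -> lo t <= c.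
Proof.
move=> h; apply: ge_sup; first by exists (H (t - 1)); exists (t - 1) => //=; lra.
by move=> _ [s /= st <-]; exact: h.
Qed.

Let le_lo s t : s < t -> H s <= lo t.
Proof.
move=> st; apply: ub_le_sup; last by exists s.
by exists (H t) => _ [r /= rt <-]; exact/ltW/jump_fun_mono.
Qed.

Let le_hi c t : (forall s, t < s -> c <= H s) -> c <= hi t.
Proof.
move=> h; apply: lb_le_inf; first by exists (H (t + 1)); exists (t + 1) => //=; lra.
by move=> _ [s /= st <-]; exact: h.
Qed.

Let hi_le s t : t < s -> hi t <= H s.
Proof.
move=> st; apply: ge_inf; last by exists s.
by exists (H t) => _ [r /= rt <-]; exact/ltW/jump_fun_mono.
Qed.

Let jump_funD (n : nat) t : H (t + n%:R) = H t + n%:R.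
Proof.
elim: n => [|n IH]; first by rewrite !addr0.
by rewrite -natr1 !addrA jump_fun1 IH.
Qed.

Let jump_funB1 t : H (t - 1) = H t - 1.
Proof. by rewrite -{2}(subrK 1 t) jump_fun1 addrK. Qed.

Let jump_fun_lt (u : R) : exists t, H t <= u.
Proof.
have [n] : exists n : nat, H 0 - u < n%:R.
  by exists (Num.bound `|H 0 - u|); rewrite (le_lt_trans (ler_norm _)) // archi_boundP.
move=> h; exists (- n%:R); have := jump_funD n (- n%:R).
by rewrite addNr; lra.
Qed.

Let jump_fun_gt (u : R) : exists t, u < H t.
Proof.
have [n h] : exists n : nat, u - H 0 < n%:R.
  by exists (Num.bound `|u - H 0|); rewrite (le_lt_trans (ler_norm _)) // archi_boundP.
by exists n%:R; rewrite -(add0r n%:R) jump_funD; lra.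
Qed.

Lemma denjoy_fibres_exist : exists lo hi, denjoy_fibres a lo hi.
Proof.
exists lo, hi; split.
- move=> t; apply: lo_le => s st; apply: le_hi => s' ts'.
  exact/ltW/jump_fun_mono/(lt_trans st).
- move=> s t st.
  apply: (@le_lt_trans _ _ (H ((2 * s + t) / 3))); first by apply: hi_le; lra.
  apply: (@lt_le_trans _ _ (H ((s + 2 * t) / 3))); last by apply: le_lo; lra.
  by apply: jump_fun_mono; lra.
(* The point whose fibre contains [u] is the supremum of the [t] with [H t <= u]. *)
- move=> u; pose E := [set t | H t <= u].
  have E0 : E !=set0 by have [t ?] := jump_fun_lt u; exists t.
  have [b ub] := jump_fun_gt u.
  have Eb : has_ubound E.
    exists b => t /= Et; rewrite leNgt; apply/negP => /(jump_fun_mono a).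
    by move: Et; rewrite /E /=; lra.
  exists (sup E); apply/andP; split.
    apply: lo_le => s /(sup_gt E0)[t Et st].
    by apply: le_trans Et; exact/ltW/jump_fun_mono.
  apply: le_hi => s sE; rewrite leNgt; apply/negP => Hs.
  suff : s <= sup E by rewrite leNgt sE.
  by apply: ub_le_sup => //; exact: ltW.
- move=> t; split; apply/eqP; rewrite eq_le; apply/andP; split.
  + by apply: lo_le => s st; have := @le_lo (s - 1) t; rewrite jump_funB1; lra.
  + rewrite -lerBrDr; apply: lo_le => s st; have := @le_lo (s + 1) (t + 1).
    by rewrite jump_fun1; lra.
  + rewrite -lerBlDr; apply: le_hi => s st; have := @hi_le (s + 1) (t + 1).
    by rewrite jump_fun1; lra.
  + by apply: le_hi => s st; have := @hi_le (s - 1) t; rewrite jump_funB1; lra.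
- move=> t; split; last first.
    move=> [k [m tE]]; have [n nP] := jump_fun_jump a k m.
    have n0' : 0 < 2 ^- n.+2 :> R by rewrite invr_gt0 exprn_gt0.
    suff : lo t + 2 ^- n.+2 <= hi t by lra.
    apply: le_hi => s' ts'; rewrite -lerBrDr; apply: lo_le => s st.
    by have := nP s s'; rewrite -tE st ts' => /(_ isT); lra.
  move=> lh; apply: contrapT => tka.
  have {}tka k m : t != k%:~R * a + m%:~R.
    by apply/eqP => h; apply: tka; exists k, m.
  have := @jump_fun_cont _ a t (hi t - lo t) tka; rewrite subr_gt0 => /(_ lh).
  by move=> [s [s' [st ts']]]; have := le_lo st; have := hi_le ts'; lra.
Qed.

End denjoy_fibres_exist.

(** * The Denjoy flow on the line *)

Section denjoy_flow.
Context {R : realType}.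
Variables (a : R) (lo hi : R -> R).
Hypothesis a_irr : irrational a.
Hypothesis fibres : denjoy_fibres a lo hi.
Implicit Types (b c s t u v : R) (k m : int).

Definition rot_group : set R := [set b | exists k m, b = k%:~R * a + m%:~R].

Lemma rot_groupD b c : rot_group b -> rot_group c -> rot_group (b + c).
Proof.
move=> [k [m ->]] [k' [m' ->]]; exists (k + k'), (m + m').
by rewrite !intrD; ring.
Qed.

Lemma rot_groupN b : rot_group b -> rot_group (- b).
Proof.
by move=> [k [m ->]]; exists (- k), (- m); rewrite !rmorphN /=; ring.
Qed.

Lemma rot_group_int m : rot_group m%:~R.
Proof. by exists 0, m; rewrite mul0r add0r. Qed.

Lemma rot_group_mul k : rot_group (k%:~R * a).
Proof. by exists k, 0; rewrite addr0. Qed.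

Lemma rot_group_muln (n : nat) : rot_group (n%:R * a).
Proof. by exists n, 0; rewrite addr0. Qed.

Lemma rot_group_id : rot_group a.
Proof. by exists 1, 0; rewrite mul1r addr0. Qed.

Let lo_hi t : lo t <= hi t. Proof. by case: fibres. Qed.

Let hi_lo s t : s < t -> hi s < lo t.
Proof. by case: fibres => _ + _ _ _; exact. Qed.

Lemma fibre_intD t m : lo (t + m%:~R) = lo t + m%:~R /\ hi (t + m%:~R) = hi t + m%:~R.
Proof.
have [_ _ _ h _] := fibres.
suff hn (n : nat) r : lo (r + n%:R) = lo r + n%:R /\ hi (r + n%:R) = hi r + n%:R.
  case: m => n; first exact: hn.
  rewrite NegzE rmorphN /=; have [] := hn n.+1 (t - n.+1%:R).
  by rewrite subrK -[n.+1%:~R]/(n.+1%:R); split; lra.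
elim: n => [|n [IH1 IH2]]; first by rewrite !addr0.
by rewrite -natr1 !addrA; have [-> ->] := h (r + n%:R); rewrite IH1 IH2.
Qed.

Definition width t := hi t - lo t.

Lemma width_ge0 t : 0 <= width t. Proof. by rewrite /width subr_ge0. Qed.

Lemma width_gt0 t : 0 < width t <-> rot_group t.
Proof. by rewrite /width subr_gt0; case: fibres => _ _ _ _; exact. Qed.

(** The nondegenerate fibres lie over a subgroup, which is stable under translation by its own
    elements. Hence [flow] never sends a degenerate fibre to a nondegenerate one or conversely. *)
Lemma width_eq0D b t : rot_group b -> (width (t + b) == 0) = (width t == 0).
Proof.
move=> Gb.
have w0 r : (width r == 0) = ~~ (0 < width r) by rewrite lt_def width_ge0 andbT negbK.
rewrite !w0; congr (~~ _); apply/idP/idP.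
  by move=> /width_gt0/(rot_groupD (rot_groupN Gb)); rewrite addrC addrK => /width_gt0.
by move=> /width_gt0/rot_groupD - /(_ _ Gb)/width_gt0.
Qed.

Definition collapse u : R := xget 0 [set t | lo t <= u <= hi t].

Lemma collapseP u : lo (collapse u) <= u <= hi (collapse u).
Proof.
have [_ _ /(_ u)[t tP] _ _] := fibres.
exact: (@xgetPex _ 0 [set t | lo t <= u <= hi t]) (ex_intro _ t tP).
Qed.

Lemma collapse_eq t u : lo t <= u <= hi t -> collapse u = t.
Proof.
move=> /andP[h1 h2]; have /andP[h3 h4] := collapseP u.
by have [/hi_lo|/hi_lo|//] := ltgtP (collapse u) t; lra.
Qed.

Lemma collapse_lo t : collapse (lo t) = t.
Proof. by apply: collapse_eq; rewrite lexx lo_hi. Qed.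

Lemma collapse_hi t : collapse (hi t) = t.
Proof. by apply: collapse_eq; rewrite lexx lo_hi. Qed.

Lemma collapse_lt u v : collapse u < collapse v -> u < v.
Proof.
by move=> /hi_lo; have /andP[_ h1] := collapseP u; have /andP[h2 _] := collapseP v; lra.
Qed.

Lemma collapse_le u v : u <= v -> collapse u <= collapse v.
Proof. by apply: contraTT; rewrite -!ltNge; exact: collapse_lt. Qed.

Lemma collapse_intD u m : collapse (u + m%:~R) = collapse u + m%:~R.
Proof.
apply: collapse_eq; have [-> ->] := fibre_intD (collapse u) m.
by have := collapseP u; lra.
Qed.

(** The displacement is 1-periodic, so the fibres over one period bound it. This is what gives the
    flow the same translation number as the rotation. *)
Lemma collapse_bounded : exists C, forall u, `|u - collapse u| <= C.
Proof.
exists (`|lo 0| + `|hi 0| + 1) => u.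
set t := collapse u; have /andP[h1 h2] := collapseP u; rewrite -/t in h1 h2.
have /andP[f1 f2] := floor_itv t; set n := Num.floor t in f1 f2.
have h3 : lo 0 + n%:~R <= lo t.
  have [<- _] := fibre_intD 0 n; rewrite add0r.
  move: f1; rewrite le_eqVlt => /predU1P[->//|/hi_lo].
  by have := lo_hi n%:~R; lra.
have h4 : hi t <= hi 0 + n%:~R + 1.
  have [_] := fibre_intD 0 (n + 1); rewrite add0r => h5.
  by have := hi_lo f2; have := lo_hi (n + 1)%:~R; rewrite h5 !intrD; lra.
have := ler_norm (lo 0); have := ler_norm (hi 0).
have := lerNnormlW (lexx `|lo 0|); have := lerNnormlW (lexx `|hi 0|).
by rewrite intrD in f2; rewrite ler_norml; lra.
Qed.

(* Moves the fibre over [t] affinely onto the fibre over [t + b]; on a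
   degenerate fibre the quotient is [0 / 0 = 0]. *)
Definition flow b u : R :=
  lo (collapse u + b) +
  (u - lo (collapse u)) / width (collapse u) * width (collapse u + b).

Let pos u := (u - lo (collapse u)) / width (collapse u).

Let pos_itv u : 0 <= pos u <= 1.
Proof.
rewrite /pos; have /andP[h1 h2] := collapseP u.
have := width_ge0 (collapse u).
rewrite le_eqVlt => /predU1P[<-|w0]; first by rewrite invr0 mulr0; lra.
by rewrite ler_pdivlMr // ler_pdivrMr // mul0r mul1r /width; lra.
Qed.

Lemma flow_fibre b u : lo (collapse u + b) <= flow b u <= hi (collapse u + b).
Proof.
rewrite /flow -/(pos u); have /andP[h1 h2] := pos_itv u.
have w0 := width_ge0 (collapse u + b).
have h3 := mulr_ge0 h1 w0.
have := ler_wpM2r w0 h2; rewrite {2}/width; lra.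
Qed.

Lemma collapse_flow b u : collapse (flow b u) = collapse u + b.
Proof. exact/collapse_eq/flow_fibre. Qed.

(** For [b] in the group the relative position inside the fibre is unchanged by [flow b]; on a
    degenerate fibre both positions are 0 by convention. *)
Lemma flowD b c u : rot_group b -> flow c (flow b u) = flow (b + c) u.
Proof.
move=> Gb; rewrite {1}/flow -/(pos _) collapse_flow.
rewrite -addrA {2}/flow -/(pos u); congr (_ + _ * _).
rewrite /pos collapse_flow {1}/flow addrC addKr.
have [w0|w0] := eqVneq (width (collapse u)) 0; last by rewrite mulfK // width_eq0D.
have /eqP -> : width (collapse u + b) == 0 by rewrite width_eq0D // w0.
by rewrite w0 !invr0 !mulr0.
Qed.

(** Deck translations are thus themselves values of the flow, and their commutation with it becomes
    a case of [flowD]. *)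
Lemma flow_int m u : flow m%:~R u = u + m%:~R.
Proof.
rewrite /flow; set t := collapse u; have [-> h] := fibre_intD t m.
have -> : width (t + m%:~R) = width t.
  by rewrite /width h; have [-> _] := fibre_intD t m; ring.
have [w0|w0] := eqVneq (width t) 0; last by rewrite divfK //; ring.
rewrite w0 mulr0 addr0; congr (_ + _); apply/eqP.
have := collapseP u; rewrite -/t; move: w0; rewrite /width.
by move=> h1 h2; apply/eqP; lra.
Qed.

Lemma flow0 u : flow 0 u = u.
Proof. by rewrite -[0]/(0%:~R) flow_int addr0. Qed.

Lemma flowK b : rot_group b -> cancel (flow b) (flow (- b)).
Proof. by move=> Gb u; rewrite flowD // subrr flow0. Qed.

Lemma flowNK b : rot_group b -> cancel (flow (- b)) (flow b).
Proof. by move=> /rot_groupN/flowK; rewrite opprK. Qed.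

Lemma flow_intD b m u : rot_group b -> flow b (u + m%:~R) = flow b u + m%:~R.
Proof.
move=> Gb; rewrite -!flow_int !flowD //; first by rewrite addrC.
exact: rot_group_int.
Qed.

Lemma flow_lt b : rot_group b -> {homo flow b : u v / u < v}.
Proof.
move=> Gb u v uv; have := collapse_le (ltW uv); rewrite le_eqVlt => /predU1P[uvE|].
  (* Two distinct points share this fibre, so it is nondegenerate and [flow b] is affine on it with
     positive slope. *)
  have wt : 0 < width (collapse u).
    have := collapseP u; have := collapseP v; rewrite -uvE /width; lra.
  have wb : 0 < width (collapse u + b).
    by apply/width_gt0/rot_groupD => //; exact/width_gt0.
  rewrite /flow -uvE ltrD2l ltr_pM2r // ltr_pM2r ?invr_gt0 //; lra.
by move=> uv'; apply: collapse_lt; rewrite !collapse_flow ltrD2r.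
Qed.

(** An increasing bijection of the line is continuous: the inverse [flow (- b)] pulls an interval
    around the value back to an interval around [u]. *)
Lemma flow_continuous b : rot_group b -> continuous (flow b).
Proof.
move=> Gb u; apply/cvgrPdist_lt => e e0.
have GN := rot_groupN Gb.
have h1 : flow (- b) (flow b u - e) < u by rewrite -{2}(flowK Gb u) flow_lt //; lra.
have h2 : u < flow (- b) (flow b u + e) by rewrite -{1}(flowK Gb u) flow_lt //; lra.
near=> v.
have v1 : flow (- b) (flow b u - e) < v by near: v; exact: lt_nbhsr.
have v2 : v < flow (- b) (flow b u + e) by near: v; exact: lt_nbhsl.
have := flow_lt Gb v1; have := flow_lt Gb v2; rewrite !(flowNK Gb).
by rewrite ltr_norml; lra.
Unshelve. all: by end_near. Qed.

Lemma iter_flow (n : nat) u : iter n (flow a) u = flow (n%:R * a) u.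
Proof.
elim: n => [|n IH]; first by rewrite mul0r flow0.
rewrite iterS IH flowD; first by rewrite -natr1 mulrDl mul1r.
exact: rot_group_muln.
Qed.

(** [collapse] turns the flow into the exact translation by [n a], at a cost bounded independently
    of [n]. *)
Lemma translation_number u :
  (iter n (flow a) u - u) / n%:R @[n --> \oo] --> a.
Proof.
have [C hC] := collapse_bounded.
apply/cvgrPdist_le => e e0; near=> n.
have n0 : 0 < n%:R :> R by rewrite ltr0n; near: n; exact: nbhs_infty_gt.
rewrite iter_flow.
set v := flow _ u.
have h1 : `|a * n%:R - (v - u)| <= C + C.
  have -> : a * n%:R - (v - u) = (u - collapse u) - (v - collapse v).
    by rewrite /v collapse_flow; ring.
  by rewrite (le_trans (ler_normB _ _)) // lerD.
have -> : a - (v - u) / n%:R = (a * n%:R - (v - u)) / n%:R.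
  by field; lra.
rewrite normrM normfV (gtr0_norm n0) ler_pdivrMr // (le_trans h1) //.
rewrite mulrC -ler_pdivrMr //; apply: (le_trans (ler_norm _)); apply/ltW.
by near: n; exact: nbhs_infty_gtr.
Unshelve. all: by end_near. Qed.

Definition cantor_lift : set R :=
  [set u | u = lo (collapse u) \/ u = hi (collapse u)].

Lemma cantor_lift_lo t : cantor_lift (lo t).
Proof. by left; rewrite collapse_lo. Qed.

Lemma cantor_lift_hi t : cantor_lift (hi t).
Proof. by right; rewrite collapse_hi. Qed.

Lemma cantor_liftE u : cantor_lift u -> exists t, u = lo t \/ u = hi t.
Proof. by exists (collapse u). Qed.

Lemma closed_cantor_lift : closed cantor_lift.
Proof.
rewrite -openC openE => u /= Ku.
have /andP[h1 h2] := collapseP u.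
have {}h1 : lo (collapse u) < u.
  by rewrite lt_neqAle h1 andbT; apply/eqP => h; apply: Ku; left.
have {}h2 : u < hi (collapse u).
  by rewrite lt_neqAle h2 andbT; apply/eqP => h; apply: Ku; right.
rewrite /interior; near=> v.
have v1 : lo (collapse u) < v by near: v; exact: lt_nbhsr.
have v2 : v < hi (collapse u) by near: v; exact: lt_nbhsl.
have -> : (~` cantor_lift) v = ~ cantor_lift v by [].
rewrite /cantor_lift /= (@collapse_eq (collapse u) v) //; last by rewrite !ltW.
by lra.
Unshelve. all: by end_near. Qed.

Lemma flow_lo b t : rot_group b -> flow b (lo t) = lo (t + b).
Proof. by rewrite /flow collapse_lo subrr !mul0r addr0. Qed.

Lemma flow_hi b t : rot_group b -> flow b (hi t) = hi (t + b).
Proof.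
move=> Gb; rewrite /flow collapse_hi -/(width t).
have [w0|w0] := eqVneq (width t) 0.
  have /eqP : width (t + b) == 0 by rewrite width_eq0D // w0.
  by rewrite w0 mul0r mul0r /width; lra.
by rewrite divff // mul1r /width; ring.
Qed.

Lemma cantor_lift_flow b u : rot_group b -> cantor_lift u -> cantor_lift (flow b u).
Proof.
move=> Gb /cantor_liftE[t [->|->]].
  by rewrite flow_lo //; exact: cantor_lift_lo.
by rewrite flow_hi //; exact: cantor_lift_hi.
Qed.

Lemma cantor_lift_intD m u : cantor_lift u -> cantor_lift (u + m%:~R).
Proof. by rewrite -flow_int; apply: cantor_lift_flow; exact: rot_group_int. Qed.

(** Density of the rotation orbit lets the flow orbit of any point enter the space between two given
    fibres. A left end [lo t] is approached from below and a right end [hi t] from above, the sides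
    on which other fibres accumulate. *)
Lemma orbit_dense_cantor_lift (L : set R) : closed L -> L !=set0 ->
  (forall b u, rot_group b -> L u -> L (flow b u)) -> cantor_lift `<=` L.
Proof.
move=> cL [u Lu] Lflow.
have visit s t : s < t -> exists2 v, L v & hi s < v < lo t.
  move=> st; have st' : s - collapse u < t - collapse u by lra.
  have [k [m h]] := rotation_orbit_dense a_irr st'.
  have Gb : rot_group (k%:~R * a + m%:~R) by exists k, m.
  exists (flow (k%:~R * a + m%:~R) u); first exact: Lflow.
  have := flow_fibre (k%:~R * a + m%:~R) u.
  set r := collapse u + _.
  have /hi_lo h1 : s < r by rewrite /r; lra.
  have /hi_lo h2 : r < t by rewrite /r; lra.
  by lra.
move=> v /cantor_liftE[t tv].
rewrite (closure_id L).1 // => B /nbhs_ballP[e /= e0 eB].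
suff [w Lw we] : exists2 w, L w & `|v - w| < e by exists w; split => //; apply: eB.
case: tv => ->.
  have /andP[_ h] := collapseP (lo t - e).
  have [|w Lw w1] := @visit (collapse (lo t - e)) t.
    have [//|/hi_lo|tE] := ltgtP (collapse (lo t - e)) t.
      by have := lo_hi t; have := collapseP (lo t - e); lra.
    by have := collapseP (lo t - e); rewrite tE; lra.
  by exists w => //; rewrite ltr_norml; lra.
have /andP[h _] := collapseP (hi t + e).
have [|w Lw w1] := @visit t (collapse (hi t + e)).
  have [//|/hi_lo|tE] := ltgtP t (collapse (hi t + e)).
    by have := lo_hi t; have := collapseP (hi t + e); lra.
  by have := collapseP (hi t + e); rewrite -tE; lra.
by exists w => //; rewrite ltr_norml; lra.
Qed.

End denjoy_flow.

(** * Passing to the circle *)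

(** A continuous map from a compact set to a Hausdorff space is closed, hence a quotient map onto
    its image. *)
Lemma quotient_continuous (T U V : topologicalType) (A : set T)
    (q : T -> U) (f : U -> V) :
  hausdorff_space U -> compact A -> {within A, continuous q} ->
  {within A, continuous (f \o q)} -> {within q @` A, continuous f}.
Proof.
move=> hU cA qA fqA; apply/continuous_closedP => B cB; apply/closed_subspaceP.
move/continuous_closedP : fqA => /(_ B cB)/closed_subspaceP[W cW WA].
exists (q @` (A `&` W)).
  apply: compact_closed => //; apply: continuous_compact.
    exact: continuous_subspaceW qA.
  exact: compact_closedI.
rewrite setIC in WA.
apply/seteqP; split => z [].
  by rewrite WA => -[t [Bt At] <-] _; split => //; exists t.
move=> Bz [t At qt]; subst z; split; last by exists t.
by exists t => //; rewrite WA.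
Qed.

Lemma hausdorff_Sigma2 : hausdorff_space Sigma2.
Proof. by apply: hausdorff_product => i; exact: discrete_hausdorff. Qed.

Lemma compact_Sigma2 : compact [set: Sigma2].
Proof.
have := @tychonoff _ (fun _ : int => _) _ (fun=> bool_compact).
by congr (compact _); rewrite eqEsubset.
Qed.

Section circle_cover.
Context {R : realType}.
Local Notation cc := (@circle_cover R).
Implicit Types (s t : R) (m : int) (z : R * R).

Lemma circle_cover_circle t : circle (cc t).
Proof. by rewrite /circle /= cos2Dsin2. Qed.

Lemma circle_coverD1 t : cc (t + 1) = cc t.
Proof.
rewrite /circle_cover mulrDr mulr1 (_ : 2 * pi = pi *+ 2) ?mulr_natl //.
by rewrite cosD2pi sinD2pi.
Qed.

Lemma circle_coverD t m : cc (t + m%:~R) = cc t.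
Proof.
have hn (n : nat) s : cc (s + n%:R) = cc s.
  elim: n => [|n IH]; first by rewrite addr0.
  by rewrite -natr1 addrA circle_coverD1 IH.
case: m => n; first exact: hn.
by rewrite NegzE rmorphN /= -(hn n.+1 (t - _)) subrK.
Qed.

Lemma circle_cover_inj s t : cc s = cc t -> exists m, s = t + m%:~R.
Proof.
move=> [hc hs]; set x := s - t.
exists (Num.floor x); suff : x - (Num.floor x)%:~R = 0 by rewrite /x; lra.
have /andP[h1 h2] := floor_itv x; rewrite intrD in h2.
set r := x - _.
have cr : cos (2 * pi * r) = 1.
  have := circle_coverD r (Num.floor x); rewrite /r subrK => -[<- _].
  have -> : 2 * pi * x = 2 * pi * s - 2 * pi * t by rewrite /x; ring.
  by rewrite cosB hc hs -!expr2 cos2Dsin2.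
apply/eqP/negPn/negP => r0.
have {}r0 : 0 < r by rewrite lt_neqAle eq_sym r0 /r; lra.
(* Half angles: [cos (2 pi r) = 1] forces [sin (pi r) = 0], whereas [pi r] lies strictly between 0
   and [pi]. *)
have : 0 < sin (pi * r).
  apply: sin_gt0_pi; rewrite mulr_gt0 ?pi_gt0 //= -[ltRHS]mulr1 ltr_pM2l ?pi_gt0 //.
  by rewrite /r; lra.
have := cos2Dsin2 (pi * r).
have e : 2 * pi * r = (pi * r) *+ 2 by rewrite mulr2n; ring.
move: cr; rewrite e cos_mulr2n mulr2n => h3 h4.
have /eqP : sin (pi * r) ^+ 2 = 0 by lra.
by rewrite sqrf_eq0 => /eqP ->; rewrite ltxx.
Qed.

Lemma circle_cover_surj z : circle z -> exists t, cc t = z.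
Proof.
case: z => x y; rewrite /circle /= => xy.
have x1 : -1 <= x <= 1.
  by apply/andP; split; nra.
have [_ cx] := acos_def x1.
have p0 : (2 * pi : R) != 0 by rewrite mulf_neq0 // gt_eqF // pi_gt0.
have y2 : 1 - x ^+ 2 = y ^+ 2 by rewrite -xy; ring.
have [y0|/ltW y0] := lerP 0 y.
  exists (acos x / (2 * pi)).
  rewrite /circle_cover mulrC divfK // cx sin_acos // y2 sqrtr_sqr.
  by rewrite ger0_norm.
exists (- acos x / (2 * pi)).
rewrite /circle_cover mulrC divfK // cosN sinN cx sin_acos // y2 sqrtr_sqr.
by rewrite ler0_norm // opprK.
Qed.

Lemma circle_cover_continuous : continuous cc.
Proof.
have h : continuous (fun t : R => 2 * pi * t) by move=> t; exact: mulrl_continuous.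
move=> t.
have hcos : cos (2 * pi * s) @[s --> t] --> cos (2 * pi * t).
  by apply: (@continuous_comp _ _ _ _ cos); [exact: h|exact: continuous_cos].
have hsin : sin (2 * pi * s) @[s --> t] --> sin (2 * pi * t).
  by apply: (@continuous_comp _ _ _ _ sin); [exact: h|exact: continuous_sin].
exact: cvg_pair hcos hsin.
Qed.

(** Replaces a periodic closed set by a compact piece with the same image, as needed for
    [quotient_continuous]. *)
Lemma circle_cover_unit (C : set R) : (forall t m, C t -> C (t + m%:~R)) ->
  cc @` C = cc @` (C `&` `[0, 1]).
Proof.
move=> Cint; apply/seteqP; split => z; last by move=> [t [Ct _] <-]; exists t.
move=> [t Ct <-]; exists (t + (- Num.floor t)%:~R).
  split; first exact: Cint.
  have := floor_itv t; rewrite intrD rmorphN /= in_itv /=; lra.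
by rewrite circle_coverD.
Qed.

Lemma compact_circle_cover (C : set R) : (forall t m, C t -> C (t + m%:~R)) ->
  closed C -> compact (cc @` C).
Proof.
move=> Cint cC; rewrite circle_cover_unit //; apply: continuous_compact.
  exact/continuous_subspaceT/circle_cover_continuous.
by rewrite setIC; apply: compact_closedI => //; exact: segment_compact.
Qed.

Lemma circle_cover_range : cc @` setT = circle.
Proof.
apply/seteqP; split => z; first by move=> [t _ <-]; exact: circle_cover_circle.
by move=> /circle_cover_surj[t <-]; exists t.
Qed.

(** Evaluates [f] at an arbitrarily chosen lift; the choice is immaterial for 1-periodic [f]. *)
Definition descend {V : Type} (f : R -> V) z : V := f (xget 0 [set t | cc t = z]).

Lemma descendE (V : Type) (f : R -> V) t :
  (forall s m, f (s + m%:~R) = f s) -> descend f (cc t) = f t.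
Proof.
move=> fint; rewrite /descend.
have /= := @xgetPex _ (0 : R) [set s | cc s = cc t] (ex_intro _ t erefl).
by move=> /circle_cover_inj[m ->].
Qed.

Lemma descend_continuous (V : topologicalType) (C : set R) (f : R -> V) :
  (forall s m, f (s + m%:~R) = f s) -> (forall t m, C t -> C (t + m%:~R)) ->
  closed C -> {within C, continuous f} -> {within cc @` C, continuous (descend f)}.
Proof.
move=> fint Cint cC fC; rewrite circle_cover_unit //.
apply: quotient_continuous.
- by apply: norm_hausdorff.
- by rewrite setIC; apply: compact_closedI => //; exact: segment_compact.
- exact/continuous_subspaceT/circle_cover_continuous.
- rewrite (_ : _ \o _ = f); last by apply/funext => t; exact: descendE.
  by apply: continuous_subspaceW fC => t [].
Qed.

End circle_cover.

(** * The Denjoy example on the circle and symbolic codings of its minimal set *)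

Section denjoy_homeomorphism.
Context {R : realType}.
Variables (a : R) (lo hi : R -> R).
Hypothesis a_irr : irrational a.
Hypothesis fibres : denjoy_fibres a lo hi.
Local Notation cc := (@circle_cover R).
Local Notation flow := (flow lo hi).
Local Notation rot_group := (rot_group a).
Local Notation cantor_lift := (cantor_lift lo hi).

Definition circle_flow b : R * R -> R * R := descend (cc \o flow b).

Lemma circle_flowE b t : rot_group b -> circle_flow b (cc t) = cc (flow b t).
Proof.
move=> Gb; rewrite /circle_flow descendE // => s m /=.
by rewrite (flow_intD fibres) // circle_coverD.
Qed.

Lemma circle_flow_continuous b : rot_group b ->
  {within circle, continuous (circle_flow b)}.
Proof.
move=> Gb; rewrite -circle_cover_range; apply: descend_continuous => //.
- by move=> s m /=; rewrite (flow_intD fibres) // circle_coverD.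
- apply: continuous_subspaceT => t; apply: continuous_comp.
    exact: (flow_continuous fibres).
  exact: circle_cover_continuous.
Qed.

Lemma circle_flow_fun b : rot_group b -> set_fun circle circle (circle_flow b).
Proof.
move=> Gb z /circle_cover_surj[t <-]; rewrite circle_flowE //.
exact: circle_cover_circle.
Qed.

Lemma circle_flowK b : rot_group b ->
  {in circle, cancel (circle_flow b) (circle_flow (- b))}.
Proof.
move=> Gb z /set_mem/circle_cover_surj[t <-]; rewrite !circle_flowE //.
  by rewrite (flowK fibres).
exact: rot_groupN.
Qed.

Lemma circle_flow_homeo b : rot_group b -> homeo_between circle circle (circle_flow b).
Proof.
move=> Gb; have GN := rot_groupN Gb; exists (circle_flow (- b)); split.
- by split; exact: circle_flow_fun.
- exact: circle_flow_continuous.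
- exact: circle_flow_continuous.
- exact: circle_flowK.
- by have := circle_flowK GN; rewrite opprK.
Qed.

Definition cantor_set : set (R * R) := cc @` cantor_lift.

Lemma cantor_liftP t : cantor_set (cc t) <-> cantor_lift t.
Proof.
split; last by exists t.
by move=> [s Ks /esym/circle_cover_inj[m ->]]; exact: (cantor_lift_intD fibres).
Qed.

Let Ga : rot_group a := rot_group_id a.
Local Notation g := (circle_flow a).

Lemma iter_circle_flow n t : iter n g (cc t) = cc (flow (n%:R * a) t).
Proof.
elim: n => [|n IH]; first by rewrite mul0r (flow0 fibres).
rewrite iterS IH circle_flowE // (flowD fibres); last exact: rot_group_muln.
by rewrite -natr1 mulrDl mul1r.
Qed.

Lemma compact_cantor_set : compact cantor_set.
Proof.
apply: compact_circle_cover; last exact: (closed_cantor_lift fibres).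
by move=> t m; exact: (cantor_lift_intD fibres).
Qed.

Lemma cantor_set_flow b : rot_group b -> circle_flow b @` cantor_set = cantor_set.
Proof.
move=> Gb; apply/seteqP; split => z.
  move=> [_ [t Kt <-] <-]; rewrite circle_flowE //; exists (flow b t) => //.
  exact: (cantor_lift_flow fibres).
move=> [t Kt <-]; have GN := rot_groupN Gb.
exists (cc (flow (- b) t)); first by exists (flow (- b) t) => //; exact: (cantor_lift_flow fibres).
by rewrite circle_flowE // (flowNK fibres).
Qed.

(** The lift of a closed invariant set is stable under the flow by [a], by [- a] and by integers,
    hence by the whole group, and [orbit_dense_cantor_lift] applies. *)
Lemma cantor_set_minimal : minimal_set circle g cantor_set.
Proof.
split.
- by move=> z [t _ <-]; exact: circle_cover_circle.
- by exists (cc (lo 0)), (lo 0) => //; exact: (cantor_lift_lo fibres).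
- exact: compact_cantor_set.
- exact: cantor_set_flow.
move=> L LK [z Lz] cL gL; apply/seteqP; split => //.
have Lcirc y : L y -> exists t, cc t = y by move=> /LK[t _ <-]; exists t.
pose L' := cc @^-1` L.
have L'int m u : L' (u + m%:~R) = L' u by rewrite /L' /preimage /= circle_coverD.
have step u : L' u -> L' (flow a u).
  by move=> Lu; rewrite /L' /= -circle_flowE // -gL; exists (cc u).
(* Backward stability needs the equality of [L] with its image: a point of [L] has a preimage in
   [L], unique up to an integer on the line. *)
have stepN u : L' u -> L' (flow (- a) u).
  rewrite {1}/L' /= -gL => -[_ /[dup] /Lcirc[t <-] Lt].
  rewrite circle_flowE // => /esym/circle_cover_inj[m ->].
  by rewrite (flow_intD fibres) ?L'int ?(flowK fibres) //; exact: rot_groupN.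
have stepn (n : nat) u : L' u -> L' (flow (n%:R * a) u) /\ L' (flow (- (n%:R * a)) u).
  move=> Lu; elim: n => [|n [IH1 IH2]]; first by rewrite mul0r oppr0 (flow0 fibres).
  have Gn := rot_group_muln a n.
  rewrite -natr1 mulrDl mul1r opprD -!(flowD fibres) //; last exact: rot_groupN.
  by split; [exact: step|exact: stepN].
suff KL : cantor_lift `<=` L' by move=> y [t /KL Lt <-].
apply: (orbit_dense_cantor_lift a_irr fibres).
- apply: preimage_closed.
    by apply/in_setP => t _; exact: circle_cover_continuous.
  by apply: compact_closed => //; exact: norm_hausdorff.
- by have [t tz] := Lcirc _ Lz; exists t; rewrite /L' /= tz.
move=> b u [k [m ->]] Lu; rewrite -(flowD fibres); last exact: rot_group_mul.
rewrite (flow_int fibres) L'int; case: k => n; first by have [] := stepn n _ Lu.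
by rewrite NegzE rmorphN mulNr; have [] := stepn n.+1 _ Lu.
Qed.

Lemma circle_flow_denjoy : denjoy_example g.
Proof.
split.
- exact: circle_flow_homeo.
- exists (flow a); last exact: (flow_lt fibres).
  by split; [exact: (flow_continuous fibres)|move=> t; rewrite circle_flowE].
- exists a => //; exists (flow a); last exact: (translation_number fibres).
  by split; [exact: (flow_continuous fibres)|move=> t; rewrite circle_flowE].
have lohi0 : lo 0 < hi 0.
  by have [_ _ _ _ ->] := fibres; exists 0, 0; rewrite mul0r addr0.
move=> /(_ (cc (lo 0)) (circle_cover_circle _)) dense0.
have K0 : cantor_lift (lo 0) by exact: (cantor_lift_lo fibres).
(* If the orbit stays in the closed [cantor_set], its closure misses the midpoint [u] of the gap
   over 0. *)
suff orbK : orbit_in circle g (cc (lo 0)) `<=` cantor_set.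
  have cK : closed cantor_set.
    by apply: compact_closed; [exact: norm_hausdorff|exact: compact_cantor_set].
  have circK : circle `<=` cantor_set.
    by apply: subset_trans dense0 _; rewrite [X in _ `<=` X](closure_id _).1 //; exact: closureS.
  pose u := (lo 0 + hi 0) / 2.
  have /circK/cantor_liftP : circle (cc u) by exact: circle_cover_circle.
  by rewrite /cantor_lift /= (@collapse_eq _ _ _ _ fibres 0); rewrite /u; lra.
move=> y [/circle_cover_surj[t <-] [n [|]]]; rewrite iter_circle_flow => e.
  rewrite -e; apply/cantor_liftP; apply: (cantor_lift_flow fibres) => //.
  exact: rot_group_muln.
apply/cantor_liftP; have Gn := rot_group_muln a n.
rewrite -(flowK fibres Gn t); apply: (cantor_lift_flow fibres).
  exact: rot_groupN.
by apply/cantor_liftP; rewrite e; apply/cantor_liftP.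
Qed.

Variable code : R -> Sigma2.
Hypothesis code_int : forall u m, code (u + m%:~R) = code u.
Hypothesis code_flow : forall u, code (flow a u) = full_shift (code u).
Hypothesis code_continuous : {within cantor_lift, continuous code}.
Hypothesis code_inj : forall u v, cantor_lift u -> cantor_lift v ->
  code u = code v -> exists m : int, v = u + m%:~R.

(** A periodic, equivariant and continuous [code] descends to the Cantor set. There it is injective,
    and by compactness a homeomorphism onto its image. *)
Lemma denjoy_code : denjoy_sets R (code @` cantor_lift).
Proof.
pose c := descend code.
have cE t : c (cc t) = code t by exact: descendE.
have cK : c @` cantor_set = code @` cantor_lift.
  by rewrite /cantor_set image_comp; apply: eq_imagel => t _; exact: cE.
have cc_cont : {within cantor_set, continuous c}.
  apply: descend_continuous => //; last exact: (closed_cantor_lift fibres).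
  by move=> t m; exact: (cantor_lift_intD fibres).
have c_inj z w : cantor_set z -> cantor_set w -> c z = c w -> z = w.
  move=> [t Kt <-] [s Ks <-]; rewrite !cE => /(code_inj Kt Ks)[m ->].
  by rewrite circle_coverD.
have shift_c z : cantor_set z -> c (g z) = full_shift (c z).
  by move=> [t _ <-]; rewrite circle_flowE // !cE.
rewrite -cK; split.
- exact: continuous_compact compact_cantor_set.
- rewrite /invariant_set -[in RHS](cantor_set_flow Ga).
  rewrite (image_comp c full_shift) (image_comp g c).
  by apply: eq_imagel => z Kz; rewrite /= shift_c.
exists g, cantor_set; split; [exact: circle_flow_denjoy|exact: cantor_set_minimal|].
pose h y := xget (0, 0) [set z | cantor_set z /\ c z = y].
have hP y : (c @` cantor_set) y -> cantor_set (h y) /\ c (h y) = y.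
  move=> [z Kz zy].
  exact: (@xgetPex _ (0, 0) [set z | cantor_set z /\ c z = y]) (ex_intro _ z (conj Kz zy)).
have hK z : cantor_set z -> h (c z) = z.
  move=> Kz; have [] := hP (c z) _; first by exists z.
  by move=> Kh ch; exact: c_inj.
exists h; last first.
  move=> y yY; have [Kh <-] := hP _ yY; rewrite hK // -shift_c // hK //.
  by rewrite -(cantor_set_flow Ga); exists (h y).
exists c; split => //.
- by split => z; [move=> /hP[]|move=> Kz; exists z].
(* The inverse [h] is continuous because [h \o c] is the identity on the Cantor set. *)
- apply: quotient_continuous => //.
  + exact: hausdorff_Sigma2.
  + exact: compact_cantor_set.
  + have idc : {within cantor_set, continuous (@id (R * R))}.
      by apply: continuous_subspaceT => z; exact: cvg_id.
    apply: subspace_eq_continuous idc.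
    by move=> z /set_mem Kz; exact/esym/hK.
- by move=> y /set_mem/hP[].
- by move=> z /set_mem; exact: hK.
Qed.

End denjoy_homeomorphism.

(** * Coding by arcs *)

Section step_location.
Context {R : realType}.
Variables (c : nat -> R) (N : nat).
Hypothesis c_lt : forall i j, (i < j <= N.+1)%N -> c i < c j.
Hypothesis c_period : c N.+1 = c 0%N + 1.

Definition step_cell (j : nat) (m : int) (u : R) : Prop :=
  (j <= N)%N /\ c j + m%:~R <= u < c j.+1 + m%:~R.

Lemma step_cell_exists u : exists j m, step_cell j m u.
Proof.
pose m := Num.floor (u - c 0%N); have /andP[] := floor_itv (u - c 0%N).
rewrite -/m intrD => h1 h2.
(* Downward search for the last cut not beyond [u]. *)
have locate n : (n <= N)%N -> u < c n.+1 + m%:~R -> exists2 j, (j <= n)%N & step_cell j m u.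
  elim: n => [|n IH] nN un; first by exists 0%N => //; split => //; lra.
  have [cu|uc] := lerP (c n.+1 + m%:~R) u.
    by exists n.+1 => //; split => //; rewrite cu un.
  by have [j jn ju] := IH (ltnW nN) uc; exists j => //; exact: leqW.
have [|j _ ju] := locate N (leqnn N); first by rewrite c_period; lra.
by exists j, m.
Qed.

Lemma step_cell_uniq j m j' m' u : step_cell j m u -> step_cell j' m' u -> j = j'.
Proof.
have c0 i : (i <= N)%N -> c 0%N <= c i.
  by case: i => // i iN; apply/ltW/c_lt => /=; rewrite ltnW.
have c1 i : (i <= N)%N -> c i.+1 <= c 0%N + 1.
  rewrite -c_period => iN; have [->//|iN'] := eqVneq i N.
  by apply/ltW/c_lt; rewrite !ltnS ltn_neqAle iN' iN leqnn.
(* All cells of index [n] lie in one period starting at [c 0 + n], so a floor recovers [n]. *)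
have mE i n : step_cell i n u -> n = Num.floor (u - c 0%N).
  move=> [iN /andP[h1 h2]]; apply/esym/floor_def; rewrite intrD.
  by have := c0 _ iN; have := c1 _ iN; lra.
move=> h h'; have := mE _ _ h'; rewrite -(mE _ _ h) => {mE} mm'; subst m'.
case: h h' => jN /andP[h1 h2] [j'N /andP[h1' h2']].
have le i i' : (i < i' <= N)%N -> c i.+1 <= c i'.
  move=> /andP[]; rewrite leq_eqVlt => /predU1P[<-//|ii' i'N].
  by apply/ltW/c_lt; rewrite ii' leqW.
have [jj'|jj'|//] := ltngtP j j'; exfalso.
  by have := le j j'; rewrite jj' j'N => /(_ isT); lra.
by have := le j' j; rewrite jj' jN => /(_ isT); lra.
Qed.

End step_location.

(** * The itinerary map of a word *)

Section coding.
Context {R : realType}.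
Variables (a : R) (lo hi : R -> R).
Hypothesis a_irr : irrational a.
Hypothesis fibres : denjoy_fibres a lo hi.
Variables (N : nat) (W : nat -> bool).
Hypothesis a_gt0 : 0 < a.
Hypothesis Na1 : N%:R * a < 1.
Hypothesis WN0 : W N != W 0%N.
Local Notation flow := (flow lo hi).
Local Notation rot_group := (rot_group a).
Local Notation cantor_lift := (cantor_lift lo hi).
Local Notation collapse := (collapse lo hi).
Implicit Types (u v t x : R) (i j : nat) (k m : int).

Let u0 := (lo 0 + hi 0) / 2.

Let gap0 : lo 0 < u0 < hi 0.
Proof.
suff : lo 0 < hi 0 by rewrite /u0; lra.
by have [_ _ _ _ ->] := fibres; exists 0, 0; rewrite mul0r addr0.
Qed.

(** [arc] lists the partition points of the rotation circle, [cut] their lifts inside the gaps, all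
    on the flow orbit of the midpoint [u0]. Index [N.+1] is the first point one turn later, so the
    last arc has length [1 - N a]. *)
Definition arc j : R := if (j <= N)%N then j%:R * a else 1.
Definition cut j : R := if (j <= N)%N then flow (j%:R * a) u0 else u0 + 1.

Lemma arc_lt i j : (i < j <= N.+1)%N -> arc i < arc j.
Proof.
move=> /andP[ij jN]; rewrite /arc -ltnS (leq_trans ij jN).
case: leqP => [_|_]; first by rewrite ltr_pM2r // ltr_nat.
apply: le_lt_trans Na1; rewrite ler_pM2r // ler_nat -ltnS.
exact: leq_trans jN.
Qed.

Lemma arc_period : arc N.+1 = arc 0 + 1.
Proof. by rewrite /arc ltnn /= mul0r add0r. Qed.

Lemma cut_period : cut N.+1 = cut 0 + 1.
Proof. by rewrite /cut ltnn /= mul0r (flow0 fibres). Qed.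

Lemma collapse_cut j : collapse (cut j) = arc j.
Proof.
have cu0 : collapse u0 = 0.
  by apply: (collapse_eq fibres); have := gap0; lra.
rewrite /cut /arc; case: ifP => _; first by rewrite (collapse_flow fibres) cu0 add0r.
by rewrite -[1]/(1%:~R) (collapse_intD fibres) cu0 add0r.
Qed.

Lemma cut_lt i j : (i < j <= N.+1)%N -> cut i < cut j.
Proof. by move=> /arc_lt ij; apply: (collapse_lt fibres); rewrite !collapse_cut. Qed.

Lemma cut_gap j : lo (arc j) < cut j < hi (arc j).
Proof.
have /andP[h1 h2] := gap0; rewrite /cut /arc; case: ifP => _.
  have Gj := rot_group_muln a j.
  rewrite -[j%:R * a]add0r -(flow_lo fibres) // -(flow_hi fibres) // add0r.
  by rewrite !(flow_lt fibres).
have [h3 h4] := fibre_intD fibres 0 1; move: h3 h4.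
by rewrite -[1%:~R]/(1 : R) add0r => -> ->; lra.
Qed.

(** This is why [letter] is locally constant at points of the Cantor set, although it jumps at every
    cut separating different letters. *)
Lemma cut_notin_cantor_lift j m : ~ cantor_lift (cut j + m%:~R).
Proof.
have := cut_gap j.
rewrite /cantor_lift /= (collapse_intD fibres) collapse_cut.
by have [-> ->] := fibre_intD fibres (arc j) m; lra.
Qed.

Local Notation cell := (step_cell cut N).

Definition letter u : bool := `[< exists j m, cell j m u /\ W j >].

Lemma letterE j m u : cell j m u -> letter u = W j.
Proof.
move=> ju; rewrite /letter; apply/asboolP/idP => [[j' [m' [j'u]]]|Wj]; last by exists j, m.
by rewrite (step_cell_uniq cut_lt cut_period j'u ju).
Qed.

Lemma letter_collapse j m u : (j <= N)%N ->
  arc j + m%:~R < collapse u < arc j.+1 + m%:~R -> letter u = W j.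
Proof.
move=> jN; rewrite -!collapse_cut -!(collapse_intD fibres) => /andP[h1 h2].
apply: (@letterE _ m); split => //.
by rewrite ltW (collapse_lt fibres).
Qed.

Lemma letter_intD u m : letter (u + m%:~R) = letter u.
Proof.
have [j [n ju]] := step_cell_exists cut_period u.
rewrite (letterE ju); apply: (@letterE _ (n + m)).
by case: ju => jN ju; split => //; rewrite intrD; lra.
Qed.

Lemma letter_near u : cantor_lift u -> \forall v \near u, letter v = letter u.
Proof.
move=> Ku; have [j [m ju]] := step_cell_exists cut_period u.
rewrite (letterE ju); case: ju => jN /andP[h1 h2].
have {}h1 : cut j + m%:~R < u.
  rewrite lt_neqAle h1 andbT; apply/eqP => h.
  by apply: (@cut_notin_cantor_lift j m); rewrite h.
near=> v; apply: (@letterE _ m); split => //; apply/andP; split.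
  by apply/ltW; near: v; exact: lt_nbhsr.
by near: v; exact: lt_nbhsl.
Unshelve. all: by end_near. Qed.

Definition code u : Sigma2 := fun k => letter (flow (k%:~R * a) u).

Lemma code_int u m : code (u + m%:~R) = code u.
Proof.
apply/funext => k; rewrite /code (flow_intD fibres) ?letter_intD //.
exact: rot_group_mul.
Qed.

Lemma code_flow u : code (flow a u) = full_shift (code u).
Proof.
apply/funext => k; rewrite /full_shift /code (flowD fibres); last exact: rot_group_id.
by rewrite intrD mulrDl mul1r addrC.
Qed.

(** Each coordinate is locally constant at [u], since the flow keeps [u] in the Cantor set and off
    the cuts. *)
Lemma code_continuous_at u : cantor_lift u -> {for u, continuous code}.
Proof.
move=> Ku; apply/cvg_sup => k B [_ [[C Cop <-] Ck] CB].
have Gk := rot_group_mul a k.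
have near_u : \forall v \near u, letter (flow (k%:~R * a) v) = letter (flow (k%:~R * a) u).
  exact: (flow_continuous fibres Gk) (letter_near (cantor_lift_flow fibres Gk Ku)).
rewrite nbhs_filterE; apply: filterS near_u => v vu; apply: CB.
by move: Ck; rewrite /preimage /= /code vu.
Qed.

Lemma code_continuous : {within cantor_lift, continuous code}.
Proof. by apply: continuous_in_subspaceT => u /set_mem; exact: code_continuous_at. Qed.

Lemma letter_lo0 m : letter (lo m%:~R) = W N.
Proof.
(* The left end of the gap over [m] comes before the cut in that gap, hence belongs to the last cell
   of the previous period. *)
apply: (@letterE _ (m - 1)); split => //.
have [h _] := fibre_intD fibres 0 m; rewrite add0r in h.
rewrite h cut_period intrD rmorphN /=; apply/andP; split; last first.
  by have := cut_gap 0; rewrite /arc /= mul0r; lra.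
suff : cut N < lo 0 + 1%:~R by rewrite -[1%:~R]/(1 : R); lra.
apply: (collapse_lt fibres).
rewrite (collapse_intD fibres) (collapse_lo fibres) collapse_cut /arc leqnn add0r.
exact: Na1.
Qed.

Lemma letter_hi0 m : letter (hi m%:~R) = W 0%N.
Proof.
apply: (@letterE _ m); split => //.
have [_ h] := fibre_intD fibres 0 m; rewrite add0r in h.
rewrite h lerD2r ltrD2r; apply/andP; split.
  by have := cut_gap 0; rewrite /arc /= mul0r; lra.
apply: (collapse_lt fibres); rewrite (collapse_hi fibres) collapse_cut.
by have := @arc_lt 0 1 isT; rewrite {1}/arc mul0r.
Qed.

(** Two distinct points of one fibre are the ends of a gap, over some [k a + m]. At place [- k] they
    sit at the two ends of the gap over [m] and read [W N] and [W 0]. *)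
Lemma code_inj_fibre u v : cantor_lift u -> cantor_lift v ->
  collapse u = collapse v -> code u = code v -> u = v.
Proof.
set t := collapse v => + + ut; rewrite /cantor_lift /= ut -/t => Ku Kv uv.
have [//|nuv] := eqVneq u v.
have [k [m tE]] : rot_group t.
  have [le _ _ _ gapP] := fibres; apply/gapP; rewrite lt_neqAle le andbT; apply/eqP => h.
  by case: Ku Kv nuv => -> [] ->; rewrite ?h eqxx.
have GN := rot_groupN (rot_group_mul a k).
have elo : code (lo t) (- k) = W N.
  rewrite /code rmorphN mulNr (flow_lo fibres) // tE.
  by rewrite addrAC subrr add0r letter_lo0.
have ehi : code (hi t) (- k) = W 0%N.
  rewrite /code rmorphN mulNr (flow_hi fibres) // tE.
  by rewrite addrAC subrr add0r letter_hi0.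
suff WW : W N = W 0%N by move: WN0; rewrite WW eqxx.
by move: uv nuv; case: Ku Kv => -> [] -> uv; rewrite ?eqxx // -elo -ehi uv.
Qed.

(* The letter function jumps at [0] modulo [1], and equality of the codes
   transports this jump along the translation by [collapse v - collapse u]. *)
Lemma code_eq_offset u v : code u = code v ->
  exists j m, (j <= N)%N /\ collapse v - collapse u = j%:R * a + m%:~R.
Proof.
move=> uv; apply: contrapT => no.
set th := collapse v - collapse u in no.
have [j [m [jN /andP[h1 h2]]]] := step_cell_exists arc_period th.
have {}h1 : arc j + m%:~R < th.
  rewrite lt_neqAle h1 andbT; apply/eqP => h; apply: no; exists j, m; split => //.
  by rewrite -h /arc jN.
(* The first two bounds keep the translate of [[- e, e]] by [th] inside arc [j]; the other two keep
   [[0, e]] in arc 0 and [[- e, 0]] in arc [N] of the previous period. *)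
pose e := Num.min (Num.min (th - (arc j + m%:~R)) (arc j.+1 + m%:~R - th))
  (Num.min (arc 1) (1 - arc N)).
have e0 : 0 < e.
  rewrite !lt_min !subr_gt0 h1 h2 {2}/arc leqnn Na1 andbT /=.
  by rewrite andbT; have := @arc_lt 0 1 isT; rewrite {1}/arc mul0r.
have /and4P[e1 e2 e3 e4] : [&& e <= th - (arc j + m%:~R), e <= arc j.+1 + m%:~R - th,
    e <= arc 1 & e <= 1 - arc N].
  by rewrite /e !ge_min !lexx !orbT.
(* By density the orbit of [u] meets any interval near 0 inside arc [i]; at that time the orbit of
   [v] is in arc [j], and equal codes give [W i = W j]. Intervals on both sides of 0 yield
   [W 0 = W j = W N]. *)
suff /(_ _ _ _) visit : forall s s' i n, (i <= N)%N -> - e <= s -> s < s' -> s' <= e ->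
    arc i + n%:~R <= s -> s' <= arc i.+1 + n%:~R -> W i = W j.
  have W0j : W 0%N = W j.
    apply: (visit 0 e 0%N 0) => //; rewrite ?addr0 //; first by lra.
    by rewrite /arc /= mul0r.
  move: WN0; rewrite (visit (- e) 0 N (-1)) // ?W0j ?eqxx //.
  - lra.
  - lra.
  - by rewrite rmorphN /= -[1%:~R]/(1:R); lra.
  - by rewrite arc_period /arc /= rmorphN /= -[1%:~R]/(1:R); lra.
move=> s s' i n iN es ss' s'e hs hs'.
have st : s - collapse u < s' - collapse u by lra.
have [k [m' km]] := rotation_orbit_dense a_irr st.
have cu : collapse (flow (k%:~R * a) u + m'%:~R) = collapse u + k%:~R * a + m'%:~R.
  by rewrite (collapse_intD fibres) (collapse_flow fibres).
have cv : collapse (flow (k%:~R * a) v + m'%:~R) = collapse v + k%:~R * a + m'%:~R.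
  by rewrite (collapse_intD fibres) (collapse_flow fibres).
have <- : letter (flow (k%:~R * a) u + m'%:~R) = W i.
  by apply: (@letter_collapse _ n) => //; rewrite cu; lra.
have <- : letter (flow (k%:~R * a) v + m'%:~R) = W j.
  by apply: (@letter_collapse _ m) => //; rewrite cv; move: e1 e2; rewrite /th; lra.
by rewrite !letter_intD; move: uv => /(congr1 (fun s : Sigma2 => s k)).
Qed.

(** Used in both directions, [code_eq_offset] writes the offset and its opposite with nonnegative
    multiples of [a]. Irrationality makes these multiples vanish, and an integer translation
    remains. *)
Lemma code_inj u v : cantor_lift u -> cantor_lift v -> code u = code v ->
  exists m, v = u + m%:~R.
Proof.
move=> Ku Kv uv.
have [j [m [_ jm]]] := code_eq_offset uv.
have [j' [m' [_ jm']]] := code_eq_offset (esym uv).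
have /eqP : (j%:Z + j'%:Z)%R = 0.
  apply: (irrational_intM a_irr (_ : _ = (- (m + m'))%:~R)).
  by rewrite rmorphN /= !intrD /=; move: jm jm'; rewrite -!pmulrn; lra.
rewrite paddr_eq0 // => /andP[/eqP[j0] _].
exists m; apply/esym/code_inj_fibre => //.
- exact: (cantor_lift_intD fibres).
- by rewrite (collapse_intD fibres); move: jm; rewrite j0 mul0r; lra.
- by rewrite code_int.
Qed.

(** A right end lies beyond the cut in its own gap, which is why the interval is closed on the
    left. *)
Lemma letter_hi i x : (i < N)%N -> i%:R * a <= x < (i.+1)%:R * a ->
  letter (hi x) = W i.
Proof.
move=> iN /andP[h1 h2]; apply: (@letterE _ 0); split; first exact: ltnW.
rewrite !addr0; apply/andP; split.
  have := cut_gap i; rewrite /arc (ltnW iN).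
  suff : hi (i%:R * a) <= hi x by lra.
  move: h1; rewrite le_eqVlt => /predU1P[->//|h1].
  by have [le /(_ _ _ h1) lt _ _ _] := fibres; have := le x; lra.
by apply: (collapse_lt fibres); rewrite (collapse_hi fibres) collapse_cut /arc iN.
Qed.

Lemma code_hi i j k x : i%:Z + k = j%:Z -> (j < N)%N ->
  i%:R * a <= x < (i.+1)%:R * a -> code (hi x) k = W j.
Proof.
move=> ikj jN ix; rewrite /code (flow_hi fibres); last exact: rot_group_mul.
have kE : k%:~R = j%:R - i%:R :> R.
  have -> : k = j%:Z - i%:Z by lia.
  by rewrite intrB.
apply: letter_hi => //.
by rewrite kE -natr1; move: ix; rewrite -natr1; lra.
Qed.

(** [code] is known to be continuous only on the Cantor set, which contains every [hi x]. So the
    preimage of [U] may be replaced by its interior, and the monotone function [hi] is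
    measurable. *)
Lemma measurable_code_hi (U : set Sigma2) : open U -> measurable ((code \o hi) @^-1` U).
Proof.
move=> oU.
have -> : (code \o hi) @^-1` U = hi @^-1` (code @^-1` U)°.
  apply/seteqP; split => x /=; last exact: (@interior_subset _ (code @^-1` U)).
  move=> Ux; apply: (code_continuous_at (cantor_lift_hi fibres x)).
  exact: open_nbhs_nbhs.
have mhi : measurable_fun setT hi.
  apply: measurable_realfun.nondecreasing_measurable => // x y.
  rewrite le_eqVlt => /predU1P[->//|xy].
  by have [le /(_ _ _ xy) lt _ _ _] := fibres; have := le y; lra.
rewrite -[X in measurable X]setTI; apply: mhi => //.
by apply: measurable_realfun.open_measurable; exact: open_interior.
Qed.

End coding.

(** All that the density arguments need from the Denjoy construction. The map [phi] is [code \o hi],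
    a measurable parametrization that turns the rotation by [a] into the shift. *)
Lemma denjoy_coding {R : realType} (a : R) (N : nat) (W : nat -> bool) :
  irrational a -> 0 < a -> N%:R * a < 1 -> W N != W 0%N ->
  exists Y (phi : R -> Sigma2),
    [/\ denjoy_sets R Y, forall x, Y (phi x),
        forall x, phi (x + 1) = phi x /\ phi (x + a) = full_shift (phi x),
        forall U, open U -> measurable (phi @^-1` U) &
        forall x i j k, i%:Z + k = j%:Z -> (j < N)%N ->
          i%:R * a <= x < i.+1%:R * a -> phi x k = W j].
Proof.
move=> a_irr a0 Na1 WN0; have [lo [hi fibres]] := denjoy_fibres_exist a.
exists (code a lo hi N W @` cantor_lift lo hi), (code a lo hi N W \o hi); split.
- apply: (denjoy_code a_irr fibres).
  + exact: (code_int fibres).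
  + exact: (code_flow fibres).
  + exact: (code_continuous fibres).
  + exact: (code_inj a_irr fibres).
- by move=> x; exists (hi x) => //; exact: (cantor_lift_hi fibres).
- move=> x; split => /=.
    by have [_ ->] := fibre_intD fibres x 1; rewrite (code_int fibres).
  by rewrite -(flow_hi fibres) ?(code_flow fibres) //; exact: rot_group_id.
- exact: (measurable_code_hi fibres).
- by move=> x i j k; exact: (code_hi fibres).
Qed.

(** * Measures *)

Section lebesgue_circle.
Context {R : realType}.
Local Notation leb := (@lebesgue_measure R).
Implicit Types (A E : set (measurableTypeR R)) (a t : R).

Lemma measurable_shift t :
  measurable_fun setT ((fun x => x + t) : measurableTypeR R -> measurableTypeR R).
Proof. by apply: measurable_funD => //; exact: measurable_cst. Qed.

(** The image of Lebesgue measure under a translation agrees with it on half-open intervals, which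
    determine it. *)
Lemma lebesgue_measure_shift t A : measurable A ->
  leb ((fun x => x + t) @^-1` A) = leb A.
Proof.
move=> mA; have mt := measurable_shift t.
pose m : {measure set (measurableTypeR R) -> \bar R} :=
  measure_function_pushforward__canonical__measure_function_Measure leb mt.
apply/esym; apply: (@lebesgue_measure_unique _ m) => // _ [[b c]] _ <-.
rewrite /m /= /pushforward.
have -> : (fun x => x + t) @^-1` `]b, c] = `]b - t, c - t]%classic.
  by apply/seteqP; split => x /=; rewrite !in_itv /=; lra.
rewrite !lebesgue_measure_itv /= !lte_fin ltrD2r; case: ifP => // _.
by rewrite -!EFinD; congr EFin; ring.
Qed.

Definition unit_law : set (measurableTypeR R) -> \bar R :=
  mrestr leb (measurable_itv `[0, 1[).

HB.instance Definition _ := Measure.on unit_law.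

Let unit_law_setT : unit_law setT = 1%E.
Proof.
by rewrite /unit_law /mrestr setTI lebesgue_measure_itv /= lte01 oppr0 adde0.
Qed.

HB.instance Definition _ := Measure_isProbability.Build _ _ _ unit_law unit_law_setT.

Lemma unit_law_itv b c : 0 <= b -> b <= c -> c <= 1 ->
  unit_law `[b, c[ = (c - b)%:E.
Proof.
move=> b0 bc c1; rewrite /unit_law /mrestr.
have -> : `[b, c[ `&` `[0, 1[ = `[b, c[%classic.
  by apply/seteqP; split => x /=; rewrite !in_itv /=; lra.
rewrite lebesgue_measure_itv /= lte_fin; case: ltP => // cb.
have -> : c = b by apply/eqP; rewrite eq_le cb bc.
by rewrite subrr.
Qed.

(** Rotating replaces [[0, 1[] by [[a, 1 + a[]; periodicity of [E] carries the excess [[1, 1 + a[]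
    back to [[0, a[]. *)
Lemma unit_law_rotate a E : 0 < a < 1 -> measurable E ->
  (forall x, E (x + 1) <-> E x) ->
  unit_law ((fun x => x + a) @^-1` E) = unit_law E.
Proof.
move=> a01 mE E1; rewrite /unit_law /mrestr.
have mI b c : measurable (E `&` `[b, c[) by exact: measurableI.
have split_itv b c d : b <= c <= d ->
    leb (E `&` `[b, d[) = (leb (E `&` `[b, c[) + leb (E `&` `[c, d[))%E.
  move=> bcd; rewrite -measureU //.
    congr (leb _); apply/seteqP; split => x /=; rewrite !in_itv /=.
      by move=> [Ex h]; have [xc|cx] := ltP x c; [left|right]; split => //; lra.
    by move=> [] [Ex h]; split => //; lra.
  by apply/seteqP; split => x //= -[[_ +] [_]]; rewrite !in_itv /=; lra.
have -> : (fun x => x + a) @^-1` E `&` `[0, 1[ =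
    (fun x => x + a) @^-1` (E `&` `[a, 1 + a[).
  by apply/seteqP; split => x /=; rewrite !in_itv /= => -[Ex h]; split => //; lra.
rewrite lebesgue_measure_shift // (split_itv a 1); last by lra.
rewrite (split_itv 0 a); last by lra.
rewrite addeC; congr (_ + _)%E.
rewrite -(lebesgue_measure_shift 1) //; congr (leb _).
apply/seteqP; split => x [/= Ex]; rewrite !in_itv /= => h; split => //=;
  rewrite ?in_itv /=; by [lra|exact/E1].
Qed.

End lebesgue_circle.

(** * Continuous functions on the shift space and their integrability *)

Section borel_Sigma2.
Context {R : realType}.
Implicit Types (f g : Sigma2 -> R) (s : Sigma2).

Lemma open_measurable_Sigma2 (U : set Sigma2) : open U -> measurable (U : set borel_Sigma2).
Proof. exact: sub_sigma_algebra. Qed.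

Lemma closed_measurable_Sigma2 (C : set Sigma2) :
  closed C -> measurable (C : set borel_Sigma2).
Proof.
move=> cC; rewrite -(setCK (C : set borel_Sigma2)); apply: measurableC.
by apply: open_measurable_Sigma2; exact: closed_openC.
Qed.

Lemma measurable_to_Sigma2 d (T : measurableType d) (phi : T -> Sigma2) :
  (forall U, open U -> measurable (phi @^-1` U)) ->
  measurable_fun setT (phi : T -> borel_Sigma2).
Proof.
move=> phiU; apply: (@measurability _ _ T borel_Sigma2 setT phi (@open Sigma2)) => //.
by move=> _ [U oU <-]; rewrite setTI; exact: phiU.
Qed.

Lemma continuous_measurable_Sigma2 f : continuous f ->
  measurable_fun setT (f : borel_Sigma2 -> R).
Proof.
move=> /continuousP cf; apply: (measurability _ (RGenOInfty.measurableE R)).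
move=> _ [_ [x ->] <-]; rewrite setTI; apply: open_measurable_Sigma2.
by apply: cf; exact: interval_open.
Qed.

Lemma full_shift_continuous : continuous full_shift.
Proof.
move=> s; apply/cvg_sup => k B [_ [[C Cop <-] Ck] CB].
suff : nbhs s ((fun t : Sigma2 => t (k + 1)) @^-1` C).
  by move=> h; rewrite nbhs_filterE; apply: filterS h => t Ct; exact: CB.
apply: (@proj_continuous int (fun=> bool) (k + 1) s).
exact: open_nbhs_nbhs.
Qed.

Lemma bounded_Sigma2 f : continuous f -> exists B, forall s, `|f s| <= B.
Proof.
move=> cf; have /compact_bounded[B [_ hB]] : compact (range f).
  apply: continuous_compact compact_Sigma2.
  exact: continuous_subspaceT.
by exists (B + 1) => s; apply: (hB (B + 1)); [rewrite ltrDl|exists s].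
Qed.

Lemma min_Sigma2 f : continuous f -> exists s, forall t, f s <= f t.
Proof.
move=> cf.
have [s _ hs] : exists2 s, s \in [set: Sigma2] & forall t, t \in [set: Sigma2] -> f s <= f t.
  apply: compact_EVT_min; first by exists point.
    exact: compact_Sigma2.
  exact: continuous_subspaceT.
by exists s => t; apply: hs; rewrite inE.
Qed.

Variable mu : probability borel_Sigma2 R.

Lemma bounded_integrable d (T : measurableType d) (P : probability T R)
    (g : T -> R) (B : R) : measurable_fun setT g -> (forall x, `|g x| <= B) ->
  P.-integrable setT (EFin \o g).
Proof.
move=> mg gB; apply: measurable_bounded_integrable => //.
  by apply: le_lt_trans (probability_le1 P measurableT) _; rewrite ltry.
by exists B; split => [|C BC x _ /=]; [exact: num_real|rewrite (le_trans (gB _)) // ltW].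
Qed.

Lemma continuous_integrable f : continuous f ->
  mu.-integrable setT (EFin \o f).
Proof.
move=> cf; have [B fB] := bounded_Sigma2 cf.
exact: bounded_integrable (continuous_measurable_Sigma2 cf) fB.
Qed.

End borel_Sigma2.

(** * Means of continuous functions and sampling *)

Section means.
Context {R : realType}.
Implicit Types (f g : Sigma2 -> R) (s t : Sigma2).

Section probability_mean.
Variable mu : probability borel_Sigma2 R.
Local Notation mean f := (Rintegral (mu : set borel_Sigma2 -> \bar R) setT f).

Lemma mean_cst c : mean (fun=> c) = c.
Proof.
by rewrite Rintegral_cst // [X in fine X](probability_setT mu) mulr1.
Qed.

Lemma meanD f g : continuous f -> continuous g ->
  mean (fun s => f s + g s) = mean f + mean g.
Proof. by move=> cf cg; apply: RintegralD => //; exact: continuous_integrable. Qed.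

Lemma meanZ c f : continuous f -> mean (fun s => c * f s) = c * mean f.
Proof. by move=> cf; apply: RintegralZl => //; exact: continuous_integrable. Qed.

Lemma le_mean f g : continuous f -> continuous g -> (forall s, f s <= g s) ->
  mean f <= mean g.
Proof. by move=> cf cg fg; apply: le_Rintegral => //; exact: continuous_integrable. Qed.

Lemma continuous_sum_Sigma2 (J : Type) (r : seq J) (F : J -> Sigma2 -> R) :
  (forall j, continuous (F j)) -> continuous (fun s => \sum_(j <- r) F j s).
Proof.
move=> cF; elim: r => [|j r IH].
  under eq_fun do rewrite big_nil.
  by move=> s; exact: cvg_cst.
under eq_fun do rewrite big_cons.
by move=> s; apply: cvgD; [exact: cF|exact: IH].
Qed.

Lemma mean_sum (J : Type) (r : seq J) (F : J -> Sigma2 -> R) :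
  (forall j, continuous (F j)) ->
  mean (fun s => \sum_(j <- r) F j s) = \sum_(j <- r) mean (F j).
Proof.
move=> cF; elim: r => [|j r IH].
  under eq_fun do rewrite big_nil.
  by rewrite big_nil mean_cst.
under eq_fun do rewrite big_cons.
by rewrite meanD // ?IH ?big_cons //; exact: continuous_sum_Sigma2.
Qed.

Lemma exists_le_mean f : continuous f -> exists s, f s <= mean f.
Proof.
move=> cf; have [s hs] := min_Sigma2 cf; exists s.
by rewrite -{1}(mean_cst (f s)); apply: le_mean => // t; exact: cvg_cst.
Qed.

(* Points are chosen greedily, each making a nonpositive inner product with the
   sum of the previous deviations; such a point exists because the deviations
   have mean zero. *)
Lemma greedy_sample (J : finType) (F : J -> Sigma2 -> R) :
  (forall j, continuous (F j)) -> exists C, forall n : nat, exists x : nat -> Sigma2,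
    \sum_j (\sum_(b < n) (F j (x b) - mean (F j))) ^+ 2 <= n%:R * C.
Proof.
move=> cF; pose D j s := F j s - mean (F j).
have cD j : continuous (D j) by move=> s; apply: cvgB; [exact: cF|exact: cvg_cst].
have D0 j : mean (D j) = 0.
  rewrite meanD //; last by move=> s; exact: cvg_cst.
  by rewrite mean_cst subrr.
have /choice[B DB] : forall j, exists b, forall s, `|D j s| <= b.
  by move=> j; exact: bounded_Sigma2.
exists (\sum_j B j ^+ 2); elim=> [|n [x IH]].
  exists (fun=> point); rewrite mul0r big1 // => j _.
  by rewrite big_ord0 expr0n.
pose S j := \sum_(b < n) D j (x b).
have ch : continuous (fun s => \sum_j S j * D j s).
  apply: continuous_sum_Sigma2 => j s; apply: cvgM; [exact: cvg_cst|exact: cD].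
have h0 : mean (fun s => \sum_j S j * D j s) = 0.
  rewrite mean_sum => [|j s]; last by apply: cvgM; [exact: cvg_cst|exact: cD].
  by apply: big1 => j _; have := meanZ (S j) (cD j); rewrite D0 mulr0.
have [t] := exists_le_mean ch; rewrite h0 => ht.
exists (fun b => if (b < n)%N then x b else t).
under eq_bigr => j _.
  rewrite big_ord_recr /= ltnn.
  under eq_bigr => b _ do rewrite ltn_ord.
  rewrite -/(S j) -/(D j t) sqrrD; over.
rewrite !big_split /= -natr1 mulrDl mul1r -addrA lerD //.
apply: (@le_trans _ _ (0 + \sum_j B j ^+ 2)); last by rewrite add0r.
apply: lerD; last first.
  by apply: ler_sum => j _; rewrite -real_normK ?num_real // lerXn2r ?nnegrE //
    (le_trans _ (DB j t)).
by lra.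
Qed.

(** The squared deviations of [greedy_sample] grow linearly in [n], so each deviation is of order
    [sqrt n], below [n e] once [n >= C / e ^ 2]. *)
Lemma sample_means (J : finType) (F : J -> Sigma2 -> R) (e : R) : 0 < e ->
  (forall j, continuous (F j)) -> exists n (x : nat -> Sigma2), (0 < n)%N /\
    forall j, `|\sum_(b < n) F j (x b) - n%:R * mean (F j)| <= n%:R * e.
Proof.
move=> e0 cF; have [C hC] := greedy_sample cF.
have [n n0 nC] : exists2 n : nat, (0 < n)%N & C / e ^+ 2 <= n%:R.
  exists (Num.bound `|C / e ^+ 2|).+1 => //.
  rewrite (le_trans (ler_norm _)) // ltW // (lt_le_trans (archi_boundP _)) //.
  by rewrite ler_nat.
have [x hx] := hC n; exists n, x; split => // j.
have -> : \sum_(b < n) F j (x b) - n%:R * mean (F j) =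
    \sum_(b < n) (F j (x b) - mean (F j)).
  by rewrite sumrB sumr_const card_ord mulr_natl.
rewrite -ler_sqr ?nnegrE ?mulr_ge0 ?(ltW e0) // real_normK ?num_real //.
apply: (@le_trans _ _ (n%:R * C)).
  apply: le_trans hx; rewrite (bigD1 j) //= lerDl sumr_ge0 // => i _.
  exact: sqr_ge0.
rewrite exprMn expr2 -mulrA ler_wpM2l //.
by rewrite -ler_pdivrMr // exprn_gt0.
Qed.

End probability_mean.

Section invariant_mean.
Variable mu : invariant_measure R.
Local Notation mean f := (Rintegral (sval mu : set borel_Sigma2 -> \bar R) setT f).

Lemma continuous_shift_iter n f : continuous f ->
  continuous (fun s => f (iter n full_shift s)).
Proof.
move=> cf; elim: n => [//|n IH].
have -> : (fun s => f (iter n.+1 full_shift s)) =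
    (fun s => f (iter n full_shift s)) \o full_shift.
  by apply/funext => s; rewrite /comp -iterSr.
by move=> s; apply: continuous_comp; [exact: full_shift_continuous|exact: IH].
Qed.

Lemma mean_shift f : continuous f -> mean (f \o full_shift) = mean f.
Proof.
move=> cf.
have mS : measurable_fun setT (full_shift : borel_Sigma2 -> borel_Sigma2).
  apply: measurable_to_Sigma2 => U oU; apply: open_measurable_Sigma2.
  by move/continuousP : full_shift_continuous; exact.
rewrite /Rintegral; congr fine.
have mf : measurable_fun setT (EFin \o f : borel_Sigma2 -> \bar R).
  by apply/measurable_EFinP; exact: continuous_measurable_Sigma2.
have cfs : continuous (f \o full_shift) by exact: (@continuous_shift_iter 1).
have := @integral_pushforward _ _ borel_Sigma2 borel_Sigma2 R full_shift mS (sval mu)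
  setT (EFin \o f) mf.
rewrite preimage_setT => /(_ (continuous_integrable _ cfs) measurableT) <-.
apply: eq_measure_integral => A mA _.
by rewrite /pushforward; exact: (svalP mu).
Qed.

Lemma mean_shift_iter n f : continuous f ->
  mean (fun s => f (iter n full_shift s)) = mean f.
Proof.
move=> cf; elim: n => [//|n IH].
rewrite -[RHS]IH -(mean_shift (continuous_shift_iter (n := n) cf)).
by apply: eq_Rintegral => s _; rewrite /comp -iterSr.
Qed.

End invariant_mean.

(** The image of Lebesgue measure on [[0, 1[] under [phi]; its invariance under the shift is the
    invariance of Lebesgue measure under rotation. *)
Lemma coded_invariant_measure (a : R) (phi : R -> Sigma2) : 0 < a < 1 ->
  (forall x, phi (x + 1) = phi x /\ phi (x + a) = full_shift (phi x)) ->
  (forall U, open U -> measurable (phi @^-1` U)) ->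
  exists nu : invariant_measure R,
    (forall A, measurable A -> sval nu A = unit_law (phi @^-1` A)) /\
    (forall f, continuous f ->
      Rintegral (sval nu : set borel_Sigma2 -> \bar R) setT f =
      Rintegral (@unit_law R) setT (f \o phi)).
Proof.
move=> a01 phi1 phiU.
have mphi : measurable_fun setT (phi : measurableTypeR R -> borel_Sigma2).
  exact: measurable_to_Sigma2.
pose X : {mfun measurableTypeR R >-> borel_Sigma2} :=
  HB.pack (phi : measurableTypeR R -> borel_Sigma2)
    (isMeasurableFun.Build _ _ _ _ _ mphi).
pose nu : probability borel_Sigma2 R := distribution (@unit_law R) X.
have nuE A : nu A = unit_law (phi @^-1` A) by [].
have nu_inv (A : set borel_Sigma2) : measurable A -> nu (full_shift @^-1` A) = nu A.
  move=> mA; rewrite !nuE -[RHS](unit_law_rotate a01).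
  - congr unit_law; apply/seteqP; split => x /=; by rewrite (phi1 x).2.
  - by rewrite -[X in measurable X]setTI; exact: (mphi measurableT).
  - by move=> x /=; rewrite (phi1 x).1.
exists (exist _ nu nu_inv); split => // f cf /=.
rewrite /Rintegral; congr fine.
have mf := continuous_measurable_Sigma2 cf.
rewrite integral_distribution //; first exact/measurable_EFinP.
have [B fB] := bounded_Sigma2 cf.
have mfphi : measurable_fun setT (f \o phi : measurableTypeR R -> R).
  exact: measurableT_comp mf mphi.
exact: (bounded_integrable (@unit_law R) mfphi (fun x => fB (phi x))).
Qed.

End means.

(** * Integrals estimated from values on disjoint pieces *)

Section blocks.
Context {R : realType} d (T : measurableType d).
Variables (P : probability T R) (g : T -> R) (B : R).
Hypothesis mg : measurable_fun setT g.
Hypothesis gB : forall x, `|g x| <= B.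

Let ig D : measurable D -> P.-integrable D (EFin \o g).
Proof.
by move=> mD; apply: integrableS (bounded_integrable P mg gB).
Qed.

Lemma Rintegral_near_cst (D : set T) (c e : R) : measurable D ->
  (forall x, D x -> `|g x - c| <= e) ->
  `|Rintegral P D g - c * fine (P D)| <= e * fine (P D).
Proof.
move=> mD ge.
have ic (r : R) : P.-integrable D (EFin \o (fun=> r)).
  apply: integrableS measurableT mD _ _ => //.
  exact: (@bounded_integrable _ _ _ _ _ `|r|).
rewrite -!Rintegral_cst // -RintegralB // ; last exact: ig.
have igc : P.-integrable D (EFin \o (fun x => g x - c)).
  by apply: integrableB (ig mD) (ic c).
apply: (le_trans (le_normr_Rintegral mD igc)).
by apply: le_Rintegral => //; exact: integrable_norm igc.
Qed.

(** Each piece contributes its own error; on the complement, of measure [1 - n a], only the bound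
    [B] is available. *)
Lemma Rintegral_blocks (n : nat) (A : nat -> set T) (c e : nat -> R) (a : R) :
  (forall j, measurable (A j)) -> trivIset setT A ->
  (forall j, (j < n)%N -> P (A j) = a%:E) ->
  (forall j x, (j < n)%N -> A j x -> `|g x - c j| <= e j) ->
  `|Rintegral P setT g - a * \sum_(j < n) c j| <=
    a * \sum_(j < n) e j + B * (1 - n%:R * a).
Proof.
move=> mA tA PA gce.
pose U k := \big[setU/set0]_(j < k) A j.
have mU k : measurable (U k) by exact: bigsetU_measurable.
have UA k : [disjoint U k & A k].
  by apply/disj_set2P; apply: (@trivIset_bigsetUI _ xpredT A) => // i j _ _; exact: tA.
have hU k : (k <= n)%N -> `|Rintegral P (U k) g - a * \sum_(j < k) c j| <= a * \sum_(j < k) e j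
    /\ P (U k) = (k%:R * a)%:E.
  elim: k => [_|k IH kn].
    by rewrite /U !big_ord0 Rintegral_set0 !mulr0 subr0 normr0 measure0 mul0r.
  have [IH1 IH2] := IH (ltnW kn).
  rewrite /U !big_ord_recr /= -/(U k) Rintegral_setU //; last exact/ig/measurableU.
  split.
    have h := Rintegral_near_cst (mA k) (gce k ^~ kn).
    rewrite (PA k kn) /= in h.
    rewrite !mulrDr opprD addrACA (le_trans (ler_normD _ _)) // lerD //.
    by rewrite ![a * _]mulrC.
  rewrite measureU //; last exact/disj_set2P.
  have PAk := PA k kn.
  by rewrite [X in (X + _)%E]IH2 [X in (_ + X)%E]PAk -EFinD -natr1 mulrDl mul1r.
have [h1 h2] := hU n (leqnn n).
have hc : `|Rintegral P (~` U n) g| <= B * (1 - n%:R * a).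
  have mC := measurableC (mU n).
  have := @Rintegral_near_cst (~` U n) 0 B mC.
  rewrite mul0r subr0 probability_setC // [X in (1 - X)%E]h2 /=.
  by apply=> x _; rewrite subr0.
rewrite -(setvU (U n)) setUC Rintegral_setU //.
- rewrite addrAC (le_trans (ler_normD _ _)) // lerD //.
- exact: measurableC.
- by apply: ig; apply: measurableU => //; exact: measurableC.
- by apply/disj_set2P; rewrite setICr.
Qed.

End blocks.

(** * Density *)

Section product_nbhs.
Variables (I : Type) (T : topologicalType).
Local Notation prodT := (prod_topology (fun _ : I => T)).

Lemma prod_nbhs_finite (x : prodT) (U : set prodT) : nbhs x U ->
  exists (J : finType) (i : J -> I) (V : J -> set T),
    (forall j, nbhs (x (i j)) (V j)) /\
    forall y : prodT, (forall j, V j (y (i j))) -> U y.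
Proof.
pose F : set_system prodT := [set W | exists (J : finType) (i : J -> I) (V : J -> set T),
    (forall j, nbhs (x (i j)) (V j)) /\
    forall y : prodT, (forall j, V j (y (i j))) -> W y].
(* [F] is the filter generated by the finite cylinders around [x]; it converges
   to [x] because it does so in every coordinate. *)
have FF : Filter F.
  split.
  - by exists void, (fun j : void => match j with end),
      (fun j : void => match j with end); split => // -[].
  - move=> A B [J [i [V [xV VA]]]] [K [k [W [xW WB]]]].
    exists (J + K)%type, (fun j => match j with inl j => i j | inr j => k j end),
      (fun j => match j with inl j => V j | inr j => W j end); split; first by case.
    move=> y Vy; split; first by apply: VA => j; exact: (Vy (inl j)).
    by apply: WB => j; exact: (Vy (inr j)).
  - move=> A B AB [J [i [V [xV VA]]]]; exists J, i, V; split => // y Vy.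
    by apply: AB; exact: VA.
suff : F --> x by exact.
apply/cvg_sup => i B [_ [[C Cop <-] Cx] CB].
exists unit, (fun=> i), (fun=> C); split.
  by move=> _; exact: open_nbhs_nbhs.
by move=> y /(_ tt) Cy; exact: CB.
Qed.

End product_nbhs.

Definition agree (L : nat) (s t : Sigma2) : Prop :=
  forall k : int, (`|k| <= L)%N -> s k = t k.

Lemma Sigma2_nbhs (s : Sigma2) (U : set Sigma2) : nbhs s U ->
  exists L, forall t, agree L s t -> U t.
Proof.
move=> /prod_nbhs_finite[J [i [V [sV VU]]]].
exists (\max_j `|i j|)%N => t st; apply: VU => j.
by rewrite -st; [exact: nbhs_singleton|exact: leq_bigmax].
Qed.

Lemma nbhs_agree (L : nat) (s : Sigma2) : \forall t \near s, agree L s t.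
Proof.
have coord (k : int) : \forall t \near s, s k = t k.
  have /(_ _) := @proj_continuous int (fun=> bool) k s.
  move=> /(_ [set s k]) h; apply: filterS (h _); first by move=> t /= ->.
  by apply: open_nbhs_nbhs; split => //; exact: discrete_open.
have coords (j : 'I_L.+1) :
    \forall t \near s, s j%:Z = t j%:Z /\ s (- j%:Z) = t (- j%:Z).
  by apply: filterI; exact: coord.
have := @filter_forall _ _ _ (nbhs s) (nbhs_filter s) coords.
apply: filterS => t st k kL.
have jL : (`|k| < L.+1)%N by [].
have [h1 h2] := st (Ordinal jL); have [k0|k0] := lerP 0 k.
  by have -> : k = (`|k|%N)%:Z by lia.
by have -> : k = - (`|k|%N)%:Z by lia.
Unshelve. all: by end_near. Qed.

(** * Approximation by Denjoy points and Denjoy measures *)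

Section density.
Context {R : realType}.
Implicit Types (f : Sigma2 -> R) (s t : Sigma2).

Lemma uniform_continuity_Sigma2 f (e : R) : continuous f -> 0 < e ->
  \forall L \near \oo, forall s t, agree L s t -> `|f s - f t| <= e.
Proof.
move=> cf e0.
have cover : \forall L \near \oo, [set: Sigma2] `<=`
    (fun s => forall t, agree L s t -> `|f s - f t| <= e).
  apply: ((compact_near_coveringP _).1 compact_Sigma2) => s _.
  have e2 : 0 < e / 2 by lra.
  have /Sigma2_nbhs[L0 hL0] : \forall t \near s, `|f s - f t| <= e / 2.
    by move/cvgrPdist_le : (cf s); exact.
  near=> s' L; move=> /= t s't.
  have ss' : agree L0 s s' by near: s'; exact: nbhs_agree.
  have LL : (L0 <= L)%N by near: L; exact: nbhs_infty_ge.
  have st : agree L0 s t.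
    by move=> k kL0; rewrite ss' // s't // (leq_trans kL0).
  have h1 := hL0 _ ss'; have h2 := hL0 _ st.
  (* Both [s'] and [t] are compared with the centre [s] of the covering neighbourhood. *)
  have -> : f s' - f t = (f s - f t) - (f s - f s') by ring.
  by rewrite (le_trans (ler_normB _ _)) //; lra.
by apply: filterS cover => L hL s t; exact: hL.
Unshelve. all: by end_near. Qed.

Lemma iter_full_shift n s k : iter n full_shift s k = s (k + n%:Z).
Proof.
elim: n s k => [|n IH] s k; first by rewrite addr0.
by rewrite iterS /full_shift IH -addrA; congr (s _); lia.
Qed.

Lemma denjoy_points_dense (O : set Sigma2) : O !=set0 -> open O ->
  exists s, O s /\ exists2 Y, denjoy_sets R Y & Y s.
Proof.
move=> [s Os] oO.
have [L hL] := Sigma2_nbhs (open_nbhs_nbhs (conj oO Os)).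
pose N := (L + L).+1.
pose V (j : nat) : bool := s (j%:Z - L%:Z).
(* The letters 0 to [L + L] copy the window of [s] around 0. Letter [N] is free and is made
   different from [W 0], as the coding requires. *)
pose W j := if (j < N)%N then V j else ~~ V 0%N.
have [a a_irr /andP[a0 aN]] : exists2 a : R, irrational a & 0 < a < N%:R^-1.
  by apply: irrational_between; rewrite invr_gt0 ltr0n.
have Na1 : N%:R * a < 1 by rewrite mulrC -ltr_pdivlMr ?ltr0n // div1r.
have WN0 : W N != W 0%N by rewrite /W ltnn /=; case: (V 0%N).
have [Y [phi [DY phiY _ _ phiW]]] := denjoy_coding a_irr a0 Na1 WN0.
(* Starting over [L a] puts the middle letter of the window at place 0. *)
exists (phi (L%:R * a)); split; last by exists Y.
apply: hL => k kL.
have [j jE] : exists j : nat, L%:Z + k = j%:Z by exists (absz (L%:Z + k)); lia.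
have jN : (j < N)%N by rewrite /N; lia.
rewrite (phiW _ L j) //; first by rewrite /W jN /V -jE addrC addKr.
by rewrite lexx /= ltr_pM2r // ltr_nat.
Qed.

Lemma sum_blocks (n M : nat) (F : nat -> nat -> R) : (0 < M)%N ->
  \sum_(j < n * M) F (j %/ M)%N (j %% M)%N = \sum_(b < n) \sum_(r < M) F b r.
Proof.
move=> M0; elim: n => [|n IH]; first by rewrite mul0n !big_ord0.
rewrite big_ord_recr /= -IH mulSnr big_split_ord /=; congr (_ + _).
apply: eq_bigr => r _; rewrite divnMDl // modnMDl.
by rewrite divn_small ?modn_small // addn0.
Qed.

Lemma sum_boundary (L M : nat) : (L + L <= M)%N ->
  \sum_(r < M) (if (L <= r < M - L)%N then 0 else 1) = (L + L)%:R :> R.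
Proof.
move=> LM; rewrite -(big_mkord xpredT (fun r => if (L <= r < M - L)%N then 0 else 1)).
rewrite (@big_cat_nat _ _ _ L) //=; last by lia.
rewrite (@big_cat_nat _ _ _ (M - L) L M) //=; [|by lia|by lia].
rewrite natrD; congr (_ + _).
  rewrite big_nat (eq_bigr (fun=> 1)) => [|r rL]; last by rewrite ifF //; lia.
  by rewrite -big_nat sumr_const_nat subn0.
rewrite big_nat big1 ?add0r => [|r ->//].
rewrite big_nat (eq_bigr (fun=> 1)) => [|r rL]; last by rewrite ifF //; lia.
by rewrite -big_nat sumr_const_nat; congr (_%:R); lia.
Qed.

Lemma block_position (i L M n : nat) (k : int) : (L <= i %% M < M - L)%N ->
  (`|k| <= L)%N -> (i < n * M)%N -> exists r : nat,
  [/\ (r < M)%N, (i %% M)%N%:Z + k = r%:Z, i%:Z + k = ((i %/ M) * M + r)%N%:Z &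
      ((i %/ M) * M + r < n * M)%N].
Proof.
move=> LM kL iN.
have M0 : (0 < M)%N by case: M LM {iN}; [rewrite sub0n ltn0 andbF|].
have iM : (i %/ M < n)%N by rewrite ltn_divLR.
have {2}-> := divn_eq i M; move: (i %/ M)%N (i %% M)%N iM LM => q p qn /andP[Lp pM].
have [r rE] : exists r : nat, p%:Z + k = r%:Z by exists (absz (p%:Z + k)); lia.
have rM : (r < M)%N by lia.
exists r; split => //; first by rewrite !PoszD -addrA rE.
rewrite (leq_trans (_ : _ < q.+1 * M)%N) //; first by rewrite mulSnr ltn_add2l.
by rewrite leq_mul2r qn orbT.
Qed.

(** At distance at least [L] from both ends of its block, a position sees the same window as the
    sampled point. Near the ends only the trivial bound [2 B] holds. *)
Lemma block_coding (phi : R -> Sigma2) (a : R) (x : nat -> Sigma2) (L M n : nat)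
    f (B e : R) : (forall s, `|f s| <= B) ->
  (forall s t, agree L s t -> `|f s - f t| <= e) ->
  (forall y i j k, i%:Z + k = j%:Z -> (j < n * M)%N ->
    i%:R * a <= y < i.+1%:R * a -> phi y k = x (j %/ M)%N (j %% M)%N%:Z) ->
  forall i y, (i < n * M)%N -> i%:R * a <= y < i.+1%:R * a ->
  `|f (phi y) - f (iter (i %% M)%N full_shift (x (i %/ M)%N))| <=
    (if (L <= i %% M < M - L)%N then e else 2 * B).
Proof.
move=> fB fL phix i y iN iy; case: ifP => [Li|_]; last first.
  rewrite (le_trans (ler_normB _ _)) //.
  by have := fB (phi y); have := fB (iter (i %% M)%N full_shift (x (i %/ M)%N)); lra.
apply: fL => k kL; have [r [rM rE irE irN]] := block_position Li kL iN.
rewrite (phix _ _ _ _ irE irN iy) divnMDl ?modnMDl; last by case: (M) rM.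
by rewrite (divn_small rM) (modn_small rM) addn0 iter_full_shift addrC rE.
Qed.

(** The errors are [2 e] from the blocks, [e] from the uncovered part of the circle, [e] from
    sampling, and [e] from replacing [n M a] by 1. The second and the last use [1 - n M a < a] and
    [a B <= e]. *)
Lemma mean_estimate (n M a B e S I I' : R) : 0 < a -> 0 < e -> 0 <= n -> 0 <= M ->
  n * M * a < 1 < n * M * a + a -> 0 <= B -> B <= n * M * e ->
  `|I| <= B -> `|S - n * (M * I)| <= n * (M * e) ->
  `|I' - a * S| <= a * (n * (2 * (M * e))) + B * (1 - n * M * a) ->
  `|I' - I| <= 5 * e.
Proof.
move=> a0 e0 n0 M0 /andP[Na1 Na2] B0 BN IB SI I'S.
set q := n * M * a in Na1 Na2 I'S.
have q0 : 0 <= 1 - q by lra.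
have qe : q * e <= e by rewrite -[leRHS]mul1r ler_pM2r // ltW.
have aB : a * B <= e.
  apply: (le_trans (_ : _ <= a * (n * M * e))); first by rewrite ler_pM2l.
  by rewrite mulrA [a * _]mulrC.
have qB : B * (1 - q) <= e.
  by apply: le_trans aB; rewrite mulrC ler_wpM2r //; lra.
have h1 : `|I' - a * S| <= 2 * e + e.
  apply: (le_trans I'S); rewrite lerD //.
  have -> : a * (n * (2 * (M * e))) = 2 * (q * e) by rewrite /q; ring.
  by rewrite ler_pM2l.
have h2 : `|a * S - q * I| <= e.
  have -> : a * S - q * I = a * (S - n * (M * I)) by rewrite /q; ring.
  rewrite normrM (gtr0_norm a0); apply: le_trans qe.
  have -> : q * e = a * (n * (M * e)) by rewrite /q; ring.
  by rewrite ler_pM2l.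
have h3 : `|q * I - I| <= e.
  have -> : q * I - I = - ((1 - q) * I) by ring.
  rewrite normrN normrM (ger0_norm q0); apply: le_trans qB.
  by rewrite mulrC ler_wpM2r.
have -> : I' - I = (I' - a * S) + (a * S - q * I) + (q * I - I) by ring.
rewrite (le_trans (ler_normD _ _)) //.
by have := ler_normD (I' - a * S) (a * S - q * I); lra.
Qed.

(** The [2 L] positions near the ends cost [2 B] each, and [4 L B] is absorbed by [M e]. *)
Lemma sum_block_error (L M : nat) (B e : R) : (L + L <= M)%N -> 0 <= B -> 0 <= e ->
  4 * L%:R * B <= M%:R * e ->
  \sum_(r < M) (if (L <= r < M - L)%N then e else 2 * B) <= 2 * (M%:R * e).
Proof.
move=> LM B0 e0 LB.
apply: (@le_trans _ _ (\sum_(r < M) (e + 2 * B * (if (L <= r < M - L)%N then 0 else 1)))).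
  by apply: ler_sum => r _; case: ifP => _; rewrite ?mulr0 ?mulr1; lra.
rewrite big_split /= sumr_const card_ord -mulr_natl -mulr_sumr sum_boundary //.
by rewrite natrD; lra.
Qed.

Lemma denjoy_measures_approx (mu : invariant_measure R) (J : finType)
    (f : J -> Sigma2 -> R) (e : R) : 0 < e -> (forall j, continuous (f j)) ->
  exists2 nu : invariant_measure R, (@denjoy_measures R) nu &
    forall j, `|Rintegral (sval nu : set borel_Sigma2 -> \bar R) setT (f j) -
      Rintegral (sval mu : set borel_Sigma2 -> \bar R) setT (f j)| <= 5 * e.
Proof.
move=> e0 cf.
have [B B0 fB] : exists2 B : R, 0 < B & forall j s, `|f j s| <= B.
  have /choice[b fb] : forall j, exists b, forall s, `|f j s| <= b.
    by move=> j; exact: bounded_Sigma2.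
  exists (\sum_j `|b j| + 1) => [|j s]; first by rewrite ltr_wpDl // sumr_ge0.
  rewrite (le_trans (fb j s)) // (bigD1 j) //= (le_trans (ler_norm _)) //.
  by rewrite -addrA lerDl addr_ge0 // sumr_ge0.
have [L hL] : exists L, forall j s t, agree L s t -> `|f j s - f j t| <= e.
  have : \forall L \near \oo, forall j, forall s t, agree L s t -> `|f j s - f j t| <= e.
    by apply: filter_forall => j; exact: uniform_continuity_Sigma2.
  by move=> [L _ /(_ L (leqnn L)) hL]; exists L.
(* The term [4 L B] pays for the ends of the blocks, the extra [B] for the arc that carries no
   sampled letter. *)
have [M LM BM] : exists2 M : nat, (L + L < M)%N & 4 * L%:R * B + B <= M%:R * e.
  exists (L + L + Num.bound `|(4 * L%:R * B + B) / e|).+1; first by lia.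
  rewrite -ler_pdivrMr // (le_trans (ler_norm _)) // ltW //.
  by rewrite (lt_le_trans (archi_boundP _)) // ler_nat; exact/leqW/leq_addl.
have M0 : (0 < M)%N by lia.
have M0R : 0 < M%:R :> R by rewrite ltr0n.
(* Sampling the orbit sums [G j] instead of [f j] gives blocks of length [M], long enough for end
   effects to be negligible. *)
pose G j s : R := \sum_(r < M) f j (iter r full_shift s).
have cG j : continuous (G j).
  by apply: continuous_sum_Sigma2 => r; exact: continuous_shift_iter.
have Me0 : 0 < M%:R * e by rewrite mulr_gt0.
have [n [x [n0 hx]]] := sample_means (sval mu) Me0 cG.
(* The invariance of [mu] enters here. *)
have meanG j : Rintegral (sval mu : set borel_Sigma2 -> \bar R) setT (G j) =
    M%:R * Rintegral (sval mu : set borel_Sigma2 -> \bar R) setT (f j).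
  rewrite mean_sum => [|r]; last exact: continuous_shift_iter.
  under eq_bigr => r _ do rewrite mean_shift_iter //.
  by rewrite sumr_const card_ord mulr_natl.
pose N := (n * M)%N.
have N0 : (0 < N)%N by rewrite muln_gt0 n0.
pose V (j : nat) : bool := x (j %/ M)%N (j %% M)%N%:Z.
(* The last letter only serves to make the word nonconstant. *)
pose W j := if (j < N)%N then V j else ~~ V 0%N.
have WN0 : W N != W 0%N by rewrite /W ltnn N0; case: (V 0%N).
(* With [a] between [1 / (N + 1)] and [1 / N], the [N] arcs of length [a] leave less than [a] of the
   circle uncovered. *)
have [a a_irr /andP[aN1 aN]] : exists2 a : R, irrational a & N.+1%:R^-1 < a < N%:R^-1.
  by apply: irrational_between; rewrite ltf_pV2 ?posrE ?ltr0n // ltr_nat.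
have a0 : 0 < a by apply: lt_trans aN1; rewrite invr_gt0 ltr0n.
have Na1 : N%:R * a < 1 by rewrite mulrC -ltr_pdivlMr ?ltr0n // div1r.
have Na2 : 1 < N%:R * a + a.
  by move: aN1; rewrite -div1r ltr_pdivrMr ?ltr0n // -natr1; lra.
have [Y [phi [DY phiY phi1 phiU phiW]]] := denjoy_coding a_irr a0 Na1 WN0.
have a1 : 0 < a < 1.
  rewrite a0 (le_lt_trans _ Na1) //.
  by rewrite -{1}(mul1r a) ler_pM2r // ler1n.
have [nu [nuE nuf]] := coded_invariant_measure a1 phi1 phiU.
exists nu.
  exists Y => //; rewrite nuE; last first.
    apply: closed_measurable_Sigma2; apply: compact_closed hausdorff_Sigma2 _.
    by case: DY.
  rewrite (_ : phi @^-1` Y = setT); first exact: probability_setT.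
  by apply/seteqP; split => // y _; exact: phiY.
move=> j; rewrite nuf //.
pose c i := f j (iter (i %% M)%N full_shift (x (i %/ M)%N)).
pose err i : R := if (L <= i %% M < M - L)%N then e else 2 * B.
pose A i : set (measurableTypeR R) := `[i%:R * a, i.+1%:R * a[%classic.
have gphi i y : (i < N)%N -> A i y -> `|f j (phi y) - c i| <= err i.
  rewrite /A /= in_itv /= => iN iy.
  apply: (block_coding (fB j) (hL j) _ iN iy) => z i' k l ik kN iz.
  by rewrite (phiW _ _ _ _ ik kN iz) /W kN.
have sum_c : \sum_(i < N) c i = \sum_(b < n) G j (x b).
  exact: (sum_blocks n (fun b r => f j (iter r full_shift (x b))) M0).
have sum_err : \sum_(i < N) err i <= n%:R * (2 * (M%:R * e)).
  rewrite (sum_blocks n (fun _ r => if (L <= r < M - L)%N then e else 2 * B) M0).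
  rewrite sumr_const card_ord -[leLHS]mulr_natl ler_wpM2l //.
  apply: sum_block_error (ltnW LM) (ltW B0) (ltW e0) _; apply: le_trans BM.
  by rewrite lerDl ltW.
have mfphi : measurable_fun setT (f j \o phi : measurableTypeR R -> R).
  apply: measurableT_comp (continuous_measurable_Sigma2 (cf j)) _.
  exact: measurable_to_Sigma2.
have mA i : measurable (A i) by exact: measurable_itv.
have tA : trivIset setT A.
  apply: ltn_trivIset => i i' ii'; apply/seteqP; split => y //= [].
  have ii'a : i'.+1%:R * a <= i%:R * a by rewrite ler_pM2r // ler_nat.
  rewrite /A /= !in_itv /= => /andP[_ yi'] /andP[iy _].
  by have := lt_le_trans yi' (le_trans ii'a iy); rewrite ltxx.
have PA i : (i < N)%N -> unit_law (A i) = a%:E.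
  move=> iN; rewrite unit_law_itv -?natr1 ?mulrDl ?mul1r.
  - by congr EFin; ring.
  - by rewrite mulr_ge0 // ltW.
  - by rewrite lerDl ltW.
  - apply: le_trans (ltW Na1).
    by rewrite -[X in _ + X]mul1r -mulrDl natr1 ler_pM2r // ler_nat.
have h2 := Rintegral_blocks mfphi (fun y => fB j (phi y)) mA tA PA gphi.
have h1 := hx j; rewrite meanG in h1; rewrite sum_c in h2.
have NE : N%:R = n%:R * M%:R :> R by rewrite /N natrM.
apply: (mean_estimate a0 e0 (ler0n R n) (ler0n R M) _ (ltW B0) _ _ h1 _).
- by rewrite -NE Na1 Na2.
- rewrite -NE; apply: (@le_trans _ _ (M%:R * e)).
    by apply: le_trans BM; rewrite lerDr !mulr_ge0 // ltW.
  by rewrite ler_pM2r // ler_nat leq_pmull.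
- have cc (r : R) : continuous (fun _ : Sigma2 => r) by move=> s; exact: cvg_cst.
  rewrite ler_norml; apply/andP; split.
    rewrite -(mean_cst (sval mu) (- B)); apply: le_mean => // s.
    by have := fB j s; rewrite ler_norml => /andP[].
  rewrite -[leRHS](mean_cst (sval mu) B); apply: le_mean => // s.
  by have := fB j s; rewrite ler_norml => /andP[].
- rewrite -NE; apply: (le_trans h2); rewrite lerD2r ler_pM2l //.
Qed.

End density.

Local Close Scope ring_scope.
Theorem proposition0p3 (R : realType) :
  dense [set s : Sigma2 | exists2 Y : set Sigma2, denjoy_sets R Y & Y s] /\
  dense (@denjoy_measures R).
Proof.
split=> [A A0 oA|A [mu Amu] oA]; first exact: denjoy_points_dense.
(* Weakly open sets are preimages under [integrals] of open sets of a product, so finitely many test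
   functions decide membership near [mu]. *)
have [V oV VA] := oA.
have Vmu : nbhs (integrals (mu : invariant_measure R)) V.
  by apply: open_nbhs_nbhs; split => //; move: Amu; rewrite -VA.
have [J [i [U [muU UV]]]] := prod_nbhs_finite Vmu.
have [e e0 he] : exists2 e : R, (0 < e)%R & forall j (r : R),
    (`|r - integrals (mu : invariant_measure R) (i j)| <= 5 * e)%R -> U j r.
  (* The factor 5 matches the accuracy of [denjoy_measures_approx]; finiteness of [J] allows one [e]
     for all test functions. *)
  have : \forall e \near (0 : R)^'+, forall j (r : R),
      (`|r - integrals (mu : invariant_measure R) (i j)| <= 5 * e)%R -> U j r.
    apply: filter_forall => j; have /nbhs_ballP[d /= d0 dU] := muU j.
    near=> e => r hr; apply: dU; rewrite /ball /= distrC (le_lt_trans hr) //.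
    by rewrite mulrC -ltr_pdivlMr //; near: e; apply: nbhs_right_lt; rewrite divr_gt0.
  move=> h; near (0 : R)^'+ => e; exists e => //.
  by near: e; exact: h.
have [nu Dnu nuf] := denjoy_measures_approx (mu : invariant_measure R)
  (f := fun j => i j : Sigma2 -> R) e0 (fun j => @cts_fun _ _ (i j)).
exists nu; split => //; rewrite -VA; apply: UV => j; apply: he; exact: nuf.
Unshelve. all: by end_near. Qed.
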